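(* Let $c_0\in(0,1)$ and $c_1>0$. For any initial value $(\widetilde z_0,\widetilde z_1)\in\mathbb{H}_0$, the system $$\widetilde z_{tt}(x,t)=\widetilde z_{xx}(x,t),\quad 0<x<1,\ t>0,$$ $$\widetilde z_x(0,t)=\tfrac{c_1}{1-c_0}\widetilde z(0,t)+\tfrac{c_0}{1-c_0}\widetilde z_t(0,t),\quad \widetilde z(1,t)=0,$$ with $(\widetilde z,\widetilde z_t)(\cdot,0)=(\widetilde z_0,\widetilde z_1)$ admits a unique solution $(\widetilde z,\widetilde z_t)\in C(0,\infty;\mathbb{H}_0)$, and it satisfies $\widetilde z_x(1,\cdot)\in L^2(0,\infty)$.
   Context: $\mathbb{H}_0=H^1_R(0,1)\times L^2(0,1)$, where $H^1_R(0,1)=\{\phi\in H^1(0,1):\phi(1)=0\}$. $C(0,\infty;X)$ denotes the continuous functions $[0,\infty)\to X$; solutions with this regularity are understood in the usual generalized (mild/weak) sense. *)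

(* Defs.v *)
From HB Require Import structures.
From mathcomp Require Import all_boot all_order all_algebra.
From mathcomp Require Import all_classical all_reals all_analysis.

Set Implicit Arguments.
Unset Strict Implicit.
Unset Printing Implicit Defensive.

Import Order.TTheory GRing.Theory Num.Theory.
Import numFieldNormedType.Exports.
Local Open Scope classical_set_scope.
Local Open Scope ring_scope.

(* Elements of L^2(D) are represented by functions R -> R, of which only the
   values on D matter, up to equality almost everywhere. *)
Definition L2 (R : realType) (D : set R) (f : R -> R) : Prop :=
  f \_ D \in Lfun (@lebesgue_measure R) 2%:E.

Definition L2norm (R : realType) (D : set R) (f : R -> R) : \bar R :=
  'N[@lebesgue_measure R]_2%:E [EFin \o (f \_ D)].

(* f is the continuous representative on [0, 1] of an element of H^1(0, 1), and
   g in L^2(0, 1) is its derivative.  H^1(0, 1) is thus the space of absolutely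
   continuous functions on [0, 1] whose derivative is in L^2(0, 1), so that the
   point values f 0 and f 1 make sense. *)
Definition has_deriv (R : realType) (f g : R -> R) : Prop :=
  L2 `]0, 1[ g /\
  forall x, 0 <= x <= 1 ->
    f x = f 0 + \int[@lebesgue_measure R]_(y in `[0, x]) g y.

Definition H1 (R : realType) (f : R -> R) : Prop := exists g, has_deriv f g.

Definition H1R (R : realType) (f : R -> R) : Prop := H1 f /\ f 1 = 0.

(* The derivative of f in H^1(0, 1), which is unique almost everywhere. *)
Definition weakD (R : realType) (f : R -> R) : R -> R :=
  xget (cst 0) [set g | has_deriv f g].

(* The space H_0 = H^1_R(0, 1) x L^2(0, 1) and the square of its norm. *)
Definition H0 (R : realType) (f g : R -> R) : Prop := H1R f /\ L2 `]0, 1[ g.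

Definition H0sqnorm (R : realType) (f g : R -> R) : \bar R :=
  (L2norm `]0%R, 1%R[ f ^+ 2 + L2norm `]0%R, 1%R[ (weakD f) ^+ 2
   + L2norm `]0%R, 1%R[ g ^+ 2)%E.

(* In what follows a space-time function z is applied to t first: z t x. *)

Definition continuous_H0 (R : realType) (z v : R -> R -> R) : Prop :=
  (forall t, 0 <= t -> H0 (z t) (v t)) /\
  (forall t, 0 <= t ->
     H0sqnorm (z s \- z t) (v s \- v t)
       @[s --> within [set s | 0 <= s] (nbhs t)] --> 0%E).

(* v t is the derivative at t of z : [0, +oo) -> L^2(0, 1), one-sided at 0. *)
Definition time_deriv (R : realType) (z v : R -> R -> R) : Prop :=
  forall t, 0 <= t ->
    L2norm `]0, 1[ (fun x => (z s x - z t x) / (s - t) - v t x)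
      @[s --> within [set s | 0 <= s] t^'] --> 0%E.

Definition time_int (R : realType) (z : R -> R -> R) (t x : R) : R :=
  \int[@lebesgue_measure R]_(s in `[0, t]) z s x.

(* Mild solutions of
     z_tt = z_xx,  z_x(0, t) = a z(0, t) + b z_t(0, t),  z(1, t) = 0.
   As a first order system this is U' = A U with U = (z, z_t), where
     A (f, g) = (g, f''),
     D(A) = {(f, g) in H^2 x H^1 | f(1) = g(1) = 0, f'(0) = a f(0) + b g(0)}.
   A mild solution is a continuous U with values in H_0 such that, for all
   t >= 0, the integral W of U over [0, t] is in D(A) and U(t) - U(0) = A W.
   The first component of this equation says that v is the time derivative of
   z, so that W = (time_int z t, z t - z0).  Below p is the derivative in x of
   time_int z t; it is in H^1, so it has point values, and its own derivative
   is v t - z1. *)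
Record mild_solution (R : realType) (a b : R) (z0 z1 : R -> R)
    (z v : R -> R -> R) : Prop := MildSolution {
  mild_continuous : continuous_H0 z v;
  mild_time_deriv : time_deriv z v;
  mild_init0 : forall x, 0 <= x <= 1 -> z 0 x = z0 x;
  mild_init1 : ae_eq (@lebesgue_measure R) `]0, 1[%classic (v 0) z1;
  mild_wave : forall t, 0 <= t -> exists p : R -> R,
    [/\ has_deriv (time_int z t) p,
        has_deriv p (v t \- z1) &
        p 0 = a * time_int z t 0 + b * (z t 0 - z0 0)] }.

(* q is the trace z_x(x0, .).  For a mild solution z, the function z t is only
   in H^1, so z_x(x0, t) is not a point value; it is the derivative in time of
   the value at x0 of the derivative in x of time_int z t, which is in H^2. *)
Definition has_dx_trace (R : realType) (z : R -> R -> R) (x0 : R) (q : R -> R)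
    : Prop :=
  forall t, 0 <= t -> exists p : R -> R,
    [/\ has_deriv (time_int z t) p,
        H1 p &
        p x0 = \int[@lebesgue_measure R]_(s in `[0, t]) q s].

(* Main.v *)
Require Import Defs.
From HB Require Import structures.
From mathcomp Require Import all_boot all_order all_algebra.
From mathcomp Require Import all_classical all_reals all_analysis.
From mathcomp Require Import measurable_realfun ring lra.
Import Order.TTheory GRing.Theory Num.Theory.
Import numFieldNormedType.Exports.
Local Open Scope classical_set_scope.
Local Open Scope ring_scope.

(* Writing y = 1 - x and a = c1 / (1 - c0), b = c0 / (1 - c0), d'Alembert's
   solution vanishing at y = 0 is phi (t + y) - phi (t - y).  The initial data
   determine u = phi' on ]-1, 1[, and with W t = phi (t + 1) - phi (t - 1), the
   trace of z at x = 0, the boundary condition becomes the neutral delay equation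
     (1 + b) u (t + 1) = (b - 1) u (t - 1) - a W t,
   which is solved step by step.  The energy identity shows that W' is in
   L^2 (0, oo); integrating the equation over [t, t + 2] bounds W t by the L^2
   norm of W' on that interval, so W and then u are in L^2.  The trace
   z_x (1, t) is - 2 u t, and the regularity of the solution is the continuity
   of translations in L^2.

   For uniqueness, the difference of two mild solutions is integrated once more
   in time; this makes it regular enough for the energy to be differentiable,
   and the energy does not increase. *)

Set Implicit Arguments.
Unset Strict Implicit.
Unset Printing Implicit Defensive.

(** * Oriented integrals and primitives *)

(** [W t] involves [u] up to time [t + 1], so the delay equation by itself is implicit. Since
    [W' t = u (t + 1) - u (t - 1)], eliminating [u (t + 1)] leaves the scalar equation
    [(1 + b) * W' = - 2 * u (t - 1) - a * W], whose forcing is already known: this makes each step,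
    of length 2, explicit. The term in [W] is also why square integrability of [u] does not follow
    from the contraction factor [(b - 1) / (1 + b)] alone: the damping [b] only controls [W'], the
    velocity at x = 0. For a mild solution z_x is merely L^2 in x, without a point value at x = 0,
    so the boundary term of its own energy cannot be written down. The energy used for uniqueness is
    that of the double time integral y of the difference: y_x and y_t are continuous in x and
    differentiable in time uniformly in x, and y_x (0, t) = a y (0, t) + b y_t (0, t) holds between
    point values. The usual energy plus a y (0, t)^2 then decreases. *)

Definition lint {R : realType} (f : R -> R) : Prop :=
  forall a b, (@lebesgue_measure R).-integrable `[a, b] (EFin \o f).

(* The oriented integral of [f] from [a] to [b]: one of the two terms is always
   the integral over a negligible set, so that Chasles' relation holds for any
   order of the bounds. *)
Definition sint {R : realType} (f : R -> R) (a b : R) : R :=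
  \int[@lebesgue_measure R]_(x in `[a, b]) f x
  - \int[@lebesgue_measure R]_(x in `[b, a]) f x.

Section SignedIntegral.
Context {R : realType}.
Implicit Types (f g : R -> R) (a b c k : R).
Local Notation mu := (@lebesgue_measure R).

Lemma lint_measurable f : lint f -> measurable_fun setT f.
Proof.
move=> lf.
have -> : [set: R] = \bigcup_n `[- n%:R, n%:R]%classic.
  apply/seteqP; split => // x _.
  exists (Num.truncn `|x|).+1 => //=; rewrite in_itv/= -ler_norml.
  by rewrite ltW// truncnS_gt.
apply/measurable_fun_bigcup => // n.
by have /integrableP[/measurable_EFinP] := lf (- n%:R) n%:R.
Qed.

Lemma measurable_lint f : measurable_fun setT f ->
  (forall a b, exists M, forall x, a <= x <= b -> `|f x| <= M) -> lint f.
Proof.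
move=> mf bf a b; have [M fM] := bf a b.
apply: (@le_integrable _ _ _ mu _ _ _ (cst M%:E)) => //.
- exact/measurable_EFinP/measurable_funTS.
- move=> x /=; rewrite in_itv/= => xab; rewrite lee_fin.
  by rewrite (le_trans (fM _ xab))// ler_norm.
- apply/integrableP; split; first exact: measurable_cst.
  rewrite integral_cst//= lebesgue_measure_itv/=.
  by case: ifP => _; rewrite ?mule0// -EFinD -EFinM ltry.
Qed.

Lemma le_lint f g : measurable_fun setT f ->
  (forall x, `|f x| <= `|g x|) -> lint g -> lint f.
Proof.
move=> mf fg lg a b; apply: le_integrable (lg a b) => //.
  exact/measurable_EFinP/measurable_funTS.
by move=> x _ /=; rewrite lee_fin.
Qed.

Lemma lintD f g : lint f -> lint g -> lint (fun x => f x + g x).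
Proof. by move=> lf lg a b; exact: (integrableD _ (lf a b) (lg a b)). Qed.

Lemma lintZ k f : lint f -> lint (fun x => k * f x).
Proof. by move=> lf a b; exact: (integrableZl _ k (lf a b)). Qed.

Lemma lintN f : lint f -> lint (fun x => - f x).
Proof. by move=> lf a b; exact: (integrableN (lf a b)). Qed.

Lemma lintB f g : lint f -> lint g -> lint (fun x => f x - g x).
Proof. by move=> lf lg; exact/lintD/lintN. Qed.

Lemma lint_norm f : lint f -> lint (fun x => `|f x|).
Proof. by move=> lf a b; exact: (integrable_abse (lf a b)). Qed.

Lemma continuous_lint f : continuous f -> lint f.
Proof.
move=> cf a b; apply: continuous_compact_integrable; first exact: segment_compact.
exact: continuous_subspaceT.
Qed.

Lemma lint_cst k : lint (cst k).
Proof. by apply: continuous_lint => x; exact: cst_continuous. Qed.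

Lemma le_sintE f a b : a <= b ->
  sint f a b = \int[mu]_(x in `[a, b]) f x.
Proof.
rewrite /sint le_eqVlt => /predU1P[<-|ab].
  by rewrite set_itv1 Rintegral_set1 subr0.
by rewrite [X in _ - X](_ : _ = 0) ?subr0// set_itv_ge ?Rintegral_set0// bnd_simp -ltNge.
Qed.

Lemma sintC f a b : sint f b a = - sint f a b.
Proof. by rewrite /sint opprB. Qed.

Lemma sintaa f a : sint f a a = 0.
Proof. by rewrite /sint subrr. Qed.

(** Anchoring both bounds at a common [M] on their left makes [sint] a difference of two values of
    one function, whatever the order of [a] and [b]; Chasles' relation follows. *)
Lemma sintE f M a b : lint f -> M <= a -> M <= b ->
  sint f a b = \int[mu]_(x in `[M, b]) f x - \int[mu]_(x in `[M, a]) f x.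
Proof.
move=> lf; wlog ab : a b / a <= b.
  move=> H Ma Mb; have [ab|/ltW ba] := leP a b; first exact: H.
  by rewrite sintC H// opprB.
move=> Ma Mb; rewrite le_sintE// Rintegral_itvB//.
rewrite Rintegral_itv_obnd_cbnd//.
by apply: integrableS (lf a b) => //; exact: subset_itv_oc_cc.
Qed.

Lemma sint_chasles f a b c : lint f -> sint f a b + sint f b c = sint f a c.
Proof.
move=> lf; pose M := Num.min a (Num.min b c).
have [Ma Mb Mc] : [/\ M <= a, M <= b & M <= c].
  by rewrite !ge_min !lexx/= !orbT.
by rewrite !(@sintE f M)//; ring.
Qed.

Lemma sintD f g a b : lint f -> lint g ->
  sint (fun x => f x + g x) a b = sint f a b + sint g a b.
Proof. by move=> lf lg; rewrite /sint !RintegralD//; ring. Qed.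

Lemma sintB f g a b : lint f -> lint g ->
  sint (fun x => f x - g x) a b = sint f a b - sint g a b.
Proof. by move=> lf lg; rewrite /sint !RintegralB//; ring. Qed.

Lemma sintZ k f a b : lint f -> sint (fun x => k * f x) a b = k * sint f a b.
Proof. by move=> lf; rewrite /sint !RintegralZl//; ring. Qed.

Lemma sintN f a b : lint f -> sint (fun x => - f x) a b = - sint f a b.
Proof.
move=> lf; rewrite -mulN1r -sintZ//; congr (sint _ a b).
by apply/funext => x; rewrite mulN1r.
Qed.

Lemma sint_cst k a b : sint (cst k) a b = k * (b - a).
Proof.
wlog ab : a b / a <= b.
  move=> H; have [ab|/ltW ba] := leP a b; first exact: H.
  by rewrite sintC H// -mulrN opprB.
rewrite le_sintE// Rintegral_cst//= lebesgue_measure_itv/= lte_fin.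
by move: ab; rewrite le_eqVlt => /predU1P[->|->//]; rewrite ltxx subrr.
Qed.

Lemma eq_sint f g a b : a <= b -> (forall x, a <= x <= b -> f x = g x) ->
  sint f a b = sint g a b.
Proof.
move=> ab fg; rewrite !le_sintE//; apply: eq_Rintegral => x.
by rewrite inE/= in_itv/=; exact: fg.
Qed.

Lemma le_sint f g a b : lint f -> lint g -> a <= b ->
  (forall x, a <= x <= b -> f x <= g x) -> sint f a b <= sint g a b.
Proof.
move=> lf lg ab fg; rewrite !le_sintE//; apply: le_Rintegral => //.
Qed.

Lemma sint_ge0 f a b : a <= b -> (forall x, a <= x <= b -> 0 <= f x) ->
  0 <= sint f a b.
Proof. by move=> ab f0; rewrite le_sintE//; exact: Rintegral_ge0. Qed.

Lemma le_normr_sint f a b : lint f -> a <= b ->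
  `|sint f a b| <= sint (fun x => `|f x|) a b.
Proof.
by move=> lf ab; rewrite !le_sintE//; exact: le_normr_Rintegral.
Qed.

Lemma sint_sub f a b c d : lint f -> (forall x, 0 <= f x) ->
  c <= a -> a <= b -> b <= d -> sint f a b <= sint f c d.
Proof.
move=> lf f0 ca ab bd; rewrite -(@sint_chasles f c a d)// -(@sint_chasles f a b d)//.
have := @sint_ge0 f _ _ ca (fun x _ => f0 x).
by have := @sint_ge0 f _ _ bd (fun x _ => f0 x); lra.
Qed.

Lemma EFin_sint f a b : lint f -> a <= b ->
  (sint f a b)%:E = (\int[mu]_(x in `[a, b]) (f x)%:E)%E.
Proof.
move=> lf ab; rewrite le_sintE// /Rintegral fineK//.
exact: (integrable_fin_num _ (lf a b)).
Qed.

End SignedIntegral.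

(** * Translations and reflections under the Lebesgue integral *)

Section AffineSubstitution.
Context {R : realType}.
Local Notation mu := (@lebesgue_measure R).

(** Half-open intervals determine Lebesgue measure, so preserving their lengths makes the image
    measure under [phi] the Lebesgue measure. The change of variables is then that of image
    measures, for the positive and negative parts separately. It serves translations and reflections
    alike. *)
Lemma integral_mpreserving (phi : R -> R) (D : set R) (f : R -> \bar R) :
  measurable_fun setT phi ->
  (forall a b, a < b -> mu (phi @^-1` `]a, b]%classic) = (b - a)%:E) ->
  measurable D -> measurable_fun setT f ->
  (\int[mu]_(x in phi @^-1` D) f (phi x) = \int[mu]_(x in D) f x)%E.
Proof.
move=> mphi Hphi mD mf.
pose mphi_mixin := @isMeasurableFun.Build _ _
  (measurableTypeR R) (measurableTypeR R) phi mphi.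
pose phi' : {mfun measurableTypeR R >-> measurableTypeR R} := HB.pack phi mphi_mixin.
have muE A : measurable A -> pushforward mu phi A = mu A.
  move=> mA.
  apply/esym/(@lebesgue_measure_unique R (pushforward mu phi')) => //= _ [[a b]] _ <-.
  rewrite /pushforward/= lebesgue_measure_itv/= lte_fin.
  case: ifPn => [ab|ab]; first by rewrite Hphi.
  by rewrite set_itv_ge ?preimage_set0 ?measure0// bnd_simp.
have ge0 (g : R -> \bar R) : measurable_fun setT g -> (forall x, (0 <= g x)%E) ->
    (\int[mu]_(x in phi @^-1` D) g (phi x) = \int[mu]_(x in D) g x)%E.
  move=> mg g0; transitivity (\int[pushforward mu phi']_(x in D) g x)%E.
    by rewrite ge0_integral_pushforward//; exact: measurable_funS mg.
  by apply: eq_measure_integral => A mA _; exact: muE.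
rewrite integralE [RHS]integralE; congr (_ - _)%E.
  rewrite -(ge0 f^\+%E)//; last exact: measurable_funepos.
  by apply: eq_integral => x _; rewrite !funeposE.
rewrite -(ge0 f^\-%E)//; last exact: measurable_funeneg.
by apply: eq_integral => x _; rewrite !funenegE.
Qed.

Lemma integral_shift (c : R) (D : set R) (f : R -> \bar R) :
  measurable D -> measurable_fun setT f ->
  (\int[mu]_(x in (fun x : R => x + c)%R @^-1` D) f (x + c)%R = \int[mu]_(x in D) f x)%E.
Proof.
move=> mD mf; apply: (@integral_mpreserving (fun x => x + c)) => //.
  exact: measurable_funD.
move=> a b ab.
have -> : (fun x => x + c) @^-1` `]a, b] = `]a - c, b - c]%classic.
  apply/seteqP; split => x /=; rewrite !in_itv/=; by rewrite ltrBlDr lerBrDr.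
by rewrite lebesgue_measure_itv/= lte_fin ltrD2r ab -EFinB opprB addrA subrK.
Qed.

Lemma integral_reflect (c : R) (D : set R) (f : R -> \bar R) :
  measurable D -> measurable_fun setT f ->
  (\int[mu]_(x in (fun x : R => c - x)%R @^-1` D) f (c - x)%R = \int[mu]_(x in D) f x)%E.
Proof.
move=> mD mf; apply: (@integral_mpreserving (fun x => c - x)) => //.
  exact: measurable_funB.
move=> a b ab.
have -> : (fun x => c - x) @^-1` `]a, b] = `[c - b, c - a[%classic.
  apply/seteqP; split => x /=; rewrite !in_itv/= => /andP[h1 h2]; apply/andP; split; lra.
rewrite lebesgue_measure_itv/= lte_fin ltrD2l ltrN2 ab -EFinB; congr EFin; ring.
Qed.

Lemma integral_shiftT (c : R) (f : R -> \bar R) : measurable_fun setT f ->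
  (\int[mu]_x f (x + c)%R = \int[mu]_x f x)%E.
Proof. by move=> mf; rewrite -(integral_shift c measurableT mf). Qed.

Lemma integral_reflectT (c : R) (f : R -> \bar R) : measurable_fun setT f ->
  (\int[mu]_x f (c - x)%R = \int[mu]_x f x)%E.
Proof. by move=> mf; rewrite -(integral_reflect c measurableT mf). Qed.

Lemma preimage_shift_itv (a b c : R) :
  (fun x : R => x + c) @^-1` `[a + c, b + c] = `[a, b]%classic.
Proof. by apply/seteqP; split => x /=; rewrite !in_itv/= !lerD2r. Qed.

Lemma preimage_reflect_itv (a b c : R) :
  (fun x : R => c - x) @^-1` `[c - b, c - a] = `[a, b]%classic.
Proof.
by apply/seteqP; split => x /=; rewrite !in_itv/= !lerD2l !lerN2 andbC.
Qed.

Lemma measurable_shift (f : R -> R) (c : R) : measurable_fun setT f ->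
  measurable_fun setT (fun x : R => f (x + c)).
Proof. by move=> mf; apply: (measurableT_comp mf); exact: measurable_funD. Qed.

Lemma measurable_reflect (f : R -> R) (c : R) : measurable_fun setT f ->
  measurable_fun setT (fun x : R => f (c - x)).
Proof. by move=> mf; apply: (measurableT_comp mf); exact: measurable_funB. Qed.

Lemma lint_shift (f : R -> R) (c : R) : lint f -> lint (fun x : R => f (x + c)).
Proof.
move=> lf a b; have mf := lint_measurable lf.
have /integrableP[_ iab] := lf (a + c) (b + c).
apply/integrableP; split.
  apply/measurable_EFinP; apply: measurable_funTS; exact: measurable_shift.
have mf' : measurable_fun setT (fun x => `|(f x)%:E|%E).
  by apply: measurableT_comp => //; exact/measurable_EFinP.
have := @integral_shift c `[a + c, b + c]%classic _ _ mf'.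
by rewrite preimage_shift_itv => ->.
Qed.

Lemma sint_shift (f : R -> R) (a b c : R) : lint f ->
  sint (fun x : R => f (x + c)) a b = sint f (a + c) (b + c).
Proof.
move=> /lint_measurable/measurable_EFinP mf.
have H a' b' : \int[mu]_(x in `[a', b']) f (x + c) = \int[mu]_(x in `[a' + c, b' + c]) f x.
  rewrite /Rintegral -(@integral_shift c `[a' + c, b' + c]%classic (EFin \o f))//.
  by rewrite preimage_shift_itv.
by rewrite /sint !H.
Qed.

Lemma lint_reflect (f : R -> R) (c : R) : lint f -> lint (fun x : R => f (c - x)).
Proof.
move=> lf a b; have mf := lint_measurable lf.
have /integrableP[_ iab] := lf (c - b) (c - a).
apply/integrableP; split.
  apply/measurable_EFinP; apply: measurable_funTS; exact: measurable_reflect.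
have mf' : measurable_fun setT (fun x => `|(f x)%:E|%E).
  by apply: measurableT_comp => //; exact/measurable_EFinP.
have := @integral_reflect c `[c - b, c - a]%classic _ _ mf'.
by rewrite preimage_reflect_itv => ->.
Qed.

Lemma sint_reflect (f : R -> R) (a b c : R) : lint f ->
  sint (fun x : R => f (c - x)) a b = sint f (c - b) (c - a).
Proof.
move=> /lint_measurable/measurable_EFinP mf.
have H a' b' : \int[mu]_(x in `[a', b']) f (c - x) = \int[mu]_(x in `[c - b', c - a']) f x.
  rewrite /Rintegral -(@integral_reflect c `[c - b', c - a']%classic (EFin \o f))//.
  by rewrite preimage_reflect_itv.
by rewrite /sint !H.
Qed.

End AffineSubstitution.

(** Integrability of the square does not give back the measurability of [f], whose sign is lost;
    hence the separate conjunct. *)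
Definition lint2 {R : realType} (f : R -> R) : Prop :=
  measurable_fun setT f /\ lint (fun x => f x ^+ 2).

(** * Locally square-integrable functions and the Cauchy-Schwarz inequality *)

Section LocalL2.
Context {R : realType}.
Implicit Types (f g : R -> R) (a b c k : R).

Lemma lint2M f g : lint2 f -> lint2 g -> lint (fun x => f x * g x).
Proof.
move=> [mf lf] [mg lg]; apply: (le_lint _ _ (lintD lf lg)).
  exact: measurable_funM.
move=> x; rewrite normrM [leRHS]ger0_norm ?addr_ge0 ?sqr_ge0//.
rewrite -(real_normK (num_real (f x))) -(real_normK (num_real (g x))).
have := sqr_ge0 (`|f x| - `|g x|); have := mulr_ge0 (normr_ge0 (f x)) (normr_ge0 (g x)).
nra.
Qed.

Lemma continuous_lint2 f : continuous f -> lint2 f.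
Proof.
move=> cf; split; first exact: continuous_measurable_fun.
by apply: continuous_lint => x; apply: cvgM; exact: cf.
Qed.

Lemma lint2_cst k : lint2 (cst k).
Proof. by apply: continuous_lint2 => x; exact: cst_continuous. Qed.

Lemma lint2_lint f : lint2 f -> lint f.
Proof.
move=> lf; have := lint2M lf (lint2_cst 1).
by congr lint; apply/funext => x /=; rewrite mulr1.
Qed.

Lemma lint2D f g : lint2 f -> lint2 g -> lint2 (fun x => f x + g x).
Proof.
move=> lf lg; split; first by apply: measurable_funD; [case: lf|case: lg].
have := lintD (lintD lf.2 (lintZ 2 (lint2M lf lg))) lg.2.
by congr lint; apply/funext => x; ring.
Qed.

Lemma lint2Z k f : lint2 f -> lint2 (fun x => k * f x).
Proof.
move=> lf; split; first by apply: measurable_funM => //; case: lf.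
by have := lintZ (k ^+ 2) lf.2; congr lint; apply/funext => x; ring.
Qed.

Lemma lint2N f : lint2 f -> lint2 (fun x => - f x).
Proof.
by move=> /(lint2Z (-1)); congr lint2; apply/funext => x; rewrite mulN1r.
Qed.

Lemma lint2B f g : lint2 f -> lint2 g -> lint2 (fun x => f x - g x).
Proof. by move=> lf lg; exact/lint2D/lint2N. Qed.

Lemma lint2_shift f c : lint2 f -> lint2 (fun x : R => f (x + c)).
Proof.
by case=> mf lf; split; [exact: measurable_shift|exact: (lint_shift c lf)].
Qed.

Lemma lint2_reflect f c : lint2 f -> lint2 (fun x : R => f (c - x)).
Proof.
by case=> mf lf; split; [exact: measurable_reflect|exact: (lint_reflect c lf)].
Qed.

Lemma cauchy_sint f a b : lint2 f -> a <= b ->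
  (sint f a b) ^+ 2 <= (b - a) * sint (fun x => f x ^+ 2) a b.
Proof.
move=> lf; rewrite le_eqVlt => /predU1P[<-|ab].
  by rewrite sintaa subrr mul0r expr0n.
have ba0 : 0 < b - a by rewrite subr_gt0.
(* [m] is the mean value of [f]; the inequality says that the integral of [(f - m) ^ 2] is
   nonnegative. *)
set m := sint f a b / (b - a).
have : 0 <= sint (fun x => (f x ^+ 2 - (2 * m) * f x) + m ^+ 2) a b.
  apply: sint_ge0; first exact: ltW.
  by move=> x _; rewrite (_ : _ + _ = (f x - m) ^+ 2) ?sqr_ge0//; ring.
have l1 := lint2_lint lf.
rewrite sintD//; last exact: lint_cst; last by apply: lintB; [exact: lf.2|exact: lintZ].
rewrite sintB//; last exact: lintZ; last exact: lf.2.
rewrite sintZ// (sint_cst (m ^+ 2)).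
have -> : sint f a b = m * (b - a) by rewrite /m divfK// gt_eqF.
move: (sint _ _ _) => S H; nra.
Qed.

End LocalL2.

(** Local absolute continuity in integral form: no pointwise derivative is involved, and [f] may be
    changed on a null set. *)
Definition primitive {R : realType} (F f : R -> R) : Prop :=
  forall a b, F b - F a = sint f a b.

(** * Primitives and the product formula *)

Section Primitive.
Context {R : realType}.
Implicit Types (f g F G : R -> R) (a b c k : R).

Lemma continuous_sint f a : lint f -> continuous (sint f a).
Proof.
move=> lf x; pose M := Num.min a x - 1.
have Mx : M < x by rewrite /M ltrBlDr gt_min ltrDl ltr01 orbT.
have Ma : M <= a by rewrite /M lerBlDr ge_min lerDl ler01.
have MN : M < x + 1 by rewrite (lt_trans Mx)// ltrDl.
have cF : {for x, continuous (fun y => \int[lebesgue_measure]_(t in `[M, y]) f t)}.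
  apply: (within_continuous_continuous MN); last by rewrite in_itv/= Mx ltrDl/=.
  exact: parameterized_integral_continuous (ltW MN) (lf _ _).
have cG : (fun y => \int[lebesgue_measure]_(t in `[M, y]) f t
    - \int[lebesgue_measure]_(t in `[M, a]) f t) y @[y --> x] --> sint f a x.
  rewrite (@sintE _ f M a x)// ?(ltW Mx)//.
  by apply: cvgB; [exact: cF|exact: cvg_cst].
apply: cvg_trans cG; apply: near_eq_cvg.
near=> y; apply/esym/sintE => //.
by near: y; exact: lt_le_nbhsr.
Unshelve. all: end_near. Qed.

Lemma primitive_sint f a c : lint f -> primitive (fun x => c + sint f a x) f.
Proof.
by move=> lf x y; rewrite -(@sint_chasles _ f a x y)//; ring.
Qed.

Lemma primitive_continuous F f : lint f -> primitive F f -> continuous F.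
Proof.
move=> lf pF; rewrite (_ : F = fun x => F 0 + sint f 0 x); last first.
  by apply/funext => x; rewrite -pF; ring.
by move=> x; apply: cvgD; [exact: cvg_cst|exact: continuous_sint].
Qed.

(** Cutting an interval where [L] takes the mean of its end values halves the increment of [L]: each
    of the two squares is a quarter of the old one, so the bound on the increment of [H] is halved.
    Iterating, that increment times [2 ^ n] stays bounded. *)
Lemma eq_const_of_quadratic (H L : R -> R) a b : continuous L -> a <= b ->
  (forall r s, a <= r -> r <= s -> s <= b ->
    L r <= L s /\ `|H s - H r| <= (L s - L r) ^+ 2) ->
  H b = H a.
Proof.
move=> cL ab HL.
have bisect n : forall r s, a <= r -> r <= s -> s <= b ->
    `|H s - H r| * 2 ^+ n <= (L s - L r) ^+ 2.
  elim: n => [|n IH] r s ar rs sb; first by rewrite mulr1; case: (HL r s).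
  have [Lrs _] := HL r s ar rs sb.
  have [c] : exists2 c, c \in `[r, s] & L c = (L r + L s) / 2.
    apply: IVT => //; first exact: continuous_subspaceT.
    by rewrite min_l// max_r// ler_pdivlMr// ler_pdivrMr//; apply/andP; split; lra.
  rewrite in_itv/= => /andP[rc cs] Lc.
  have alg (x y z p u v : R) : 0 <= p -> z <= y + x ->
      x * p <= ((u + v) / 2 - u) ^+ 2 -> y * p <= (v - (u + v) / 2) ^+ 2 ->
      z * (2 * p) <= (v - u) ^+ 2.
    by move=> p0 zxy xp yp; have := ler_wpM2r p0 zxy; nra.
  rewrite exprS; apply: alg (exprn_ge0 n (ler0n R 2)) _ _ _; last 2 first.
  - by rewrite -Lc; exact: IH r c ar rc (le_trans cs sb).
  - by rewrite -Lc; exact: IH c s (le_trans ar rc) cs sb.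
  - by apply: le_trans (ler_normD _ _); rewrite addrA subrK.
apply/eqP; rewrite -subr_eq0 -normr_le0 leNgt; apply/negP => H0.
(* As [2 ^ n > n], this [n] violates the bound of [bisect]. *)
pose n := (Num.truncn ((L b - L a) ^+ 2 / `|H b - H a|)).+1.
have := bisect n a b (lexx _) ab (lexx _).
apply/negP; rewrite -ltNge mulrC -ltr_pdivrMr//.
rewrite (lt_trans (truncnS_gt _))// -natrX ltr_nat.
exact: ltn_expl.
Qed.

Lemma lintMc f G : lint f -> continuous G -> lint (fun x => f x * G x).
Proof.
move=> lf cG a b.
have /compact_bounded[M [_ HM]] : compact (G @` `[a, b]%classic).
  apply: continuous_compact; last exact: segment_compact.
  exact: continuous_subspaceT.
apply: (@le_integrable _ _ _ (@lebesgue_measure R) _ _ _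
    (EFin \o (fun x => (`|M| + 1) * `|f x|))) => //.
- apply/measurable_EFinP; apply: measurable_funTS; apply: measurable_funM.
    exact: lint_measurable.
  exact: continuous_measurable_fun.
- move=> x xab; rewrite lee_fin !normrM mulrC normr_id ler_wpM2r//.
  rewrite [leRHS]ger0_norm ?addr_ge0//.
  apply: (HM (`|M| + 1)); last by exists x.
  by rewrite (le_lt_trans (ler_norm M))// ltrDl.
- exact: (lintZ _ (lint_norm lf) a b).
Qed.

(* With [L] the primitive of [|f| + |g|], the error of the product formula over
   [r, s] is at most [(L s - L r) ^ 2], which is negligible once [a, b] is cut
   into pieces on which [L] varies little. *)
Lemma primitiveM F G f g : lint f -> lint g -> primitive F f -> primitive G g ->
  primitive (fun x => F x * G x) (fun x => f x * G x + F x * g x).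
Proof.
move=> lf lg pF pG.
have cF := primitive_continuous lf pF; have cG := primitive_continuous lg pG.
have lh : lint (fun x => f x * G x + F x * g x).
  apply: lintD; first exact: lintMc.
  by have := lintMc lg cF; congr lint; apply/funext => x; rewrite mulrC.
suff le a b : a <= b -> F b * G b - F a * G a = sint (fun x => f x * G x + F x * g x) a b.
  move=> a b; have [|/ltW ba] := leP a b; first exact: le.
  by rewrite sintC -le// opprB.
move=> ab.
pose h := fun x => f x * G x + F x * g x.
pose H x := F x * G x - sint h a x.
pose l := fun x => `|f x| + `|g x|.
have ll : lint l by exact/lintD/lint_norm/lg/lint_norm.
suff : H b = H a by rewrite /H sintaa -/h; lra.
apply: (@eq_const_of_quadratic _ (sint l a)) => //; first exact: continuous_sint.
move=> r s ar rs sb.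
have El : sint l a s - sint l a r = sint l r s.
  by rewrite -(@sint_chasles _ l a r s)//; ring.
have l0 x : 0 <= l x by rewrite addr_ge0.
split; first by rewrite -subr_ge0 El sint_ge0.
rewrite El.
have -> : H s - H r = sint (fun y => f y * (G s - G y) + g y * (F r - F y)) r s.
  rewrite /H.
  have -> : sint h a s = sint h a r + sint h r s by rewrite sint_chasles.
  rewrite (_ : (fun y => _) = fun y => (G s * f y + F r * g y) - h y); last first.
    by apply/funext => y; rewrite /h; ring.
  rewrite (sintB _ _ (lintD (lintZ (G s) lf) (lintZ (F r) lg)) lh).
  rewrite (sintD _ _ (lintZ (G s) lf) (lintZ (F r) lg)).
  rewrite !sintZ// -pF -pG; ring.
have lk : lint (fun y => f y * (G s - G y) + g y * (F r - F y)).
  apply: lintD; apply: lintMc => // y; apply: cvgB; try exact: cvg_cst.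
    exact: cG.
  exact: cF.
apply: (le_trans (le_normr_sint lk rs)).
apply: (@le_trans _ _ (sint (fun y => sint l r s * l y) r s)); last first.
  by rewrite sintZ// expr2.
apply: le_sint rs _; [exact: lint_norm|exact: (lintZ (sint l r s) ll)|].
move=> y /andP[ry ys].
have L0 c d : r <= c -> c <= d -> d <= s -> sint l c d <= sint l r s.
  by move=> *; exact: sint_sub.
have sub (u : R -> R) c d : lint u -> (forall x, `|u x| <= l x) ->
    r <= c -> c <= d -> d <= s -> `|sint u c d| <= sint l r s.
  move=> lu ul rc cd ds; apply: (le_trans (le_normr_sint lu cd)).
  apply: le_trans (L0 c d rc cd ds).
  by apply: le_sint => //; exact: lint_norm.
apply: (le_trans (ler_normD _ _)); rewrite !normrM mulrDr.
rewrite lerD//; rewrite mulrC ler_wpM2r//.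
- by rewrite pG; apply: sub => // x; rewrite /l lerDr.
- by rewrite distrC pF; apply: sub => // x; rewrite /l lerDl.
Qed.

End Primitive.

(** * The delay equation *)

Section DelayEquation.
Context {R : realType}.
Implicit Types (f g F : R -> R).

Lemma primitive_C1 F f : continuous f ->
  (forall x, is_derive x (1 : R) F (f x)) -> primitive F f.
Proof.
move=> cf dF.
have cF : continuous F.
  by move=> x; apply: differentiable_continuous; apply/derivable1_diffP; case: (dF x).
suff le a b : a < b -> F b - F a = sint f a b.
  move=> a b; have [ab|ba|->] := ltgtP a b; first exact: le.
    by rewrite sintC -le// opprB.
  by rewrite sintaa subrr.
move=> ab; rewrite le_sintE ?ltW// /Rintegral (@continuous_FTC2 _ f F)//.
- exact: continuous_subspaceT.
- split; first by move=> x _; case: (dF x).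
    exact/cvg_at_right_filter/cF.
  exact/cvg_at_left_filter/cF.
- by move=> x _; rewrite derive1E; case: (dF x).
Qed.

Lemma lint2_if (c : R) f g : lint2 f -> lint2 g ->
  lint2 (fun s => if s < c then f s else g s).
Proof.
move=> lf lg.
have mh : measurable_fun setT (fun s : R => if s < c then f s else g s).
  apply: measurable_fun_ifT; [|by case: lf|by case: lg].
  exact: measurable_fun_ltr.
split => //.
apply: (le_lint _ _ (lintD lf.2 lg.2)); first exact: measurable_funX.
move=> x; rewrite !ger0_norm ?addr_ge0 ?sqr_ge0//.
by case: ifP => _; rewrite ?lerDl ?lerDr sqr_ge0.
Qed.

Variables (kap k m w0 : R) (u0 : R -> R).
Hypothesis lu0 : lint2 u0.

(* Duhamel's formula for [W' + k * W = - m * f (. - 1)] with [W 0 = w0]. *)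
Definition delay_W f (t : R) : R :=
  expR (- k * t) * (w0 - m * sint (fun r => expR (k * r) * f (r - 1)) 0 t).

(* The value of [delay_op f] at [s] only depends on the values of [f] up to
   [s - 2], so that iterating [delay_op] from [u0] is stationary on any bounded
   above interval; the limit is the solution of the delay equation. *)
Definition delay_op f (s : R) : R :=
  if s < 1 then u0 s else kap * f (s - 2) - k * delay_W f (s - 1).

Let continuous_exp c : continuous (fun t : R => expR (c * t)).
Proof.
move=> x; apply: (@continuous_comp _ _ _ (fun t => c * t) expR).
  by apply: cvgM; [exact: cvg_cst|exact: cvg_id].
exact: continuous_expR.
Qed.

Let lint_exp_shift f : lint2 f -> lint (fun r => expR (k * r) * f (r - 1)).
Proof.
move=> lf; rewrite (_ : (fun r => _) = fun r => f (r - 1) * expR (k * r)); last first.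
  by apply/funext => r; rewrite mulrC.
apply: lintMc; last exact: continuous_exp.
exact/lint2_lint/(lint2_shift (-1)).
Qed.

Lemma primitive_delay_W f : lint2 f ->
  primitive (delay_W f) (fun t => - (k * delay_W f t) - m * f (t - 1)).
Proof.
move=> lf.
have pe : primitive (fun t => expR (- k * t)) (fun t => - k * expR (- k * t)).
  apply: primitive_C1; first by move=> x; apply: cvgM; [exact: cvg_cst|exact: continuous_exp].
  move=> x; by apply: is_derive_eq; rewrite /GRing.scale/= mulr1 mulrC.
have pV := primitive_sint 0 w0 (lintZ (- m) (lint_exp_shift lf)).
have le : lint (fun t => - k * expR (- k * t)).
  exact/lintZ/continuous_lint/continuous_exp.
have := primitiveM le (lintZ (- m) (lint_exp_shift lf)) pe pV.
congr primitive; apply/funext => t; rewrite /delay_W (sintZ (- m) _ _ (lint_exp_shift lf)).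
  by ring.
have := expRxMexpNx_1 (k * t); rewrite -mulNr => e1.
set S := sint _ _ _.
transitivity (- (k * (expR (- k * t) * (w0 - m * S)))
  - m * (expR (k * t) * expR (- k * t)) * f (t - 1)); first by ring.
by rewrite e1; ring.
Qed.

Lemma continuous_delay_W f : lint2 f -> continuous (delay_W f).
Proof.
move=> lf x; apply: cvgM; first exact: continuous_exp.
apply: cvgB; first exact: cvg_cst.
by apply: cvgM; [exact: cvg_cst|exact/continuous_sint/lint_exp_shift].
Qed.

Lemma lint2_delay_op f : lint2 f -> lint2 (delay_op f).
Proof.
move=> lf; apply: lint2_if => //; apply: lint2B.
  exact/(lint2Z kap)/(lint2_shift (-2)).
exact/(lint2Z k)/(lint2_shift (-1))/continuous_lint2/continuous_delay_W.
Qed.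

(** [delay_W f (s - 1)] integrates [f (r - 1)] for [r] up to [s - 1], so both terms look back by at
    least 2. *)
Lemma eq_delay_op f g (s : R) : (forall r, r <= s - 2 -> f r = g r) ->
  delay_op f s = delay_op g s.
Proof.
move=> fg; rewrite /delay_op; case: ltP => // s1.
rewrite fg// /delay_W; congr (_ - k * (_ * (_ - m * _))).
apply: eq_sint; first by rewrite subr_ge0.
by move=> r /andP[_ rs]; rewrite fg//; lra.
Qed.

Let U n := iter n delay_op u0.

Let lint2_U n : lint2 (U n).
Proof. by elim: n => [//|n IH]; exact: lint2_delay_op. Qed.

(** The initial data settle the values below 1 and each iteration settles an interval of length 2
    more, hence the bound [2 n + 1]. *)
Let U_stable n p (s : R) : (n <= p)%N -> s < n.*2.+1%:R -> U p s = U n s.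
Proof.
have step q : forall s, s < q.*2.+1%:R -> U q.+1 s = U q s.
  elim: q => [|q IH] {}s sq; first by rewrite /U/= /delay_op sq.
  apply: eq_delay_op => r rs; apply: IH.
  by move: sq; rewrite doubleS -2!addn2 -[in X in X -> _]addn1 !natrD; lra.
move=> /subnK <- sn; elim: (p - n)%N => [//|q IH].
rewrite addSn step//; apply: (lt_le_trans sn).
by rewrite ler_nat ltnS leq_double leq_addl.
Qed.

Lemma delay_solution : exists u : R -> R,
  [/\ lint2 u, forall s, s < 1 -> u s = u0 s &
      forall s, 1 <= s -> u s = kap * u (s - 2) - k * delay_W u (s - 1)].
Proof.
pose N (s : R) := (Num.truncn `|s|).+1.
pose u s := U (N s) s.
have Ns s : s < (N s).*2.+1%:R.
  apply: (le_lt_trans (ler_norm s)); apply: (lt_le_trans (truncnS_gt _)).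
  by rewrite ler_nat -addnn ltnW// ltnS leq_addr.
have uE n s : s < n.*2.+1%:R -> u s = U n s.
  move=> sn; rewrite /u -(@U_stable (N s) (maxn n (N s))) ?leq_maxr//.
  by rewrite -(@U_stable n (maxn n (N s))) ?leq_maxl.
(* At each point the sequence [U n] is eventually constant, so [u] is a pointwise limit of
   measurable functions. *)
have mu : measurable_fun setT u.
  apply: (@measurable_fun_cvg _ _ _ setT U) => [n|x _]; first by case: (lint2_U n).
  apply: cvg_near_cst; exists (N x) => // n /= xn.
  by rewrite (@U_stable (N x)).
have lu : lint2 u.
  split=> // a b; pose n := N b.
  have := (lint2_U n).2 a b; apply: eq_integrable => //= x.
  rewrite inE/= in_itv/= => /andP[_ xb]; rewrite (uE n)//.
  exact: le_lt_trans (Ns b).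
have uT s : u s = delay_op u s.
  rewrite (@uE (N s).+1 s); last first.
    by apply: (lt_le_trans (Ns s)); rewrite ler_nat ltnS leq_double leqnSn.
  apply: eq_delay_op => r rs; apply: esym; apply: (uE (N s)).
  by apply: (le_lt_trans rs); have := Ns s; lra.
exists u; split => // s s1; first by rewrite uT /delay_op s1.
by rewrite uT /delay_op ltNge s1.
Qed.

End DelayEquation.

(** * Square integrability of the solution of the delay equation *)

Section Energy.
Context {R : realType}.
Local Notation mu := (@lebesgue_measure R).

Lemma eq_sint_oo (f g : R -> R) a b : lint f -> lint g -> a <= b ->
  (forall x, a < x < b -> f x = g x) -> sint f a b = sint g a b.
Proof.
move=> lf lg ab fg; rewrite !le_sintE// /Rintegral; congr fine.
apply: eq_integral_itv_bounded.
- by apply: measurable_funTS; exact: lint_measurable.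
- by apply: measurable_funTS; exact: lint_measurable.
- by move=> x; rewrite in_itv/=; exact: fg.
Qed.

Lemma bounded_sint_integral (f : R -> R) (M : R) : lint f -> (forall x, 0 <= f x) ->
  (forall n : nat, sint f (- n%:R) n%:R <= M) -> (\int[mu]_x (f x)%:E <= M%:E)%E.
Proof.
move=> lf f0 fM.
have setTE : [set: R] = \bigcup_n `[- n%:R, n%:R]%classic.
  apply/seteqP; split => // x _.
  exists (Num.truncn `|x|).+1 => //=; rewrite in_itv/= -ler_norml.
  by rewrite ltW// truncnS_gt.
rewrite setTE.
have cv : (\int[mu]_(x in `[(- n%:R)%R, n%:R]) (f x)%:E @[n --> \oo] -->
    \int[mu]_(x in \bigcup_n `[(- n%:R)%R, n%:R]%classic) (f x)%:E)%E.
  apply: (@ge0_nondecreasing_set_cvg_integral _ (measurableTypeR R) R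
    (fun n => `[(- n%:R)%R, n%:R]%classic) (EFin \o f) mu) => //.
  - apply/nondecreasing_seqP => n; rewrite subsetEset; apply: subset_itv; rewrite bnd_simp.
      by rewrite lerN2 ler_nat.
    by rewrite ler_nat.
  - by move=> n; apply/measurable_EFinP; apply: measurable_funTS; exact: lint_measurable.
  - by move=> n x _; rewrite lee_fin.
rewrite -(cvg_lim _ cv)//; apply: lime_le; first by apply/cvg_ex; eexists; exact: cv.
apply: nearW => n; rewrite -EFin_sint ?lee_fin//.
by rewrite (@le_trans _ _ 0)// oppr_le0.
Qed.

Variables (a b : R) (a0 : 0 < a) (b0 : 0 < b).
Variables (u W : R -> R).
(** For [t >= 0] this is [u (t + 1) - u (t - 1)], with [u (t + 1)] eliminated by the delay
    equation. *)
Let w t := - ((2 * u (t - 1) + a * W t) / (1 + b)).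
Hypothesis lu : lint2 u.
Hypothesis pW : primitive W w.
Hypothesis cW : continuous W.
Hypothesis W0 : W 0 = sint u (- 1) 1.
Hypothesis uW : forall t, 0 <= t ->
  (1 + b) * u (t + 1) = (b - 1) * u (t - 1) - a * W t.
Hypothesis u_lt : forall s, s < - 1 -> u s = 0.

Let b1 : 1 + b != 0. Proof. by rewrite gt_eqF// addr_gt0. Qed.

Let wE t : (1 + b) * w t = - (2 * u (t - 1) + a * W t).
Proof. by rewrite /w mulrN mulrC divfK. Qed.

Let lw : lint2 w.
Proof.
rewrite (_ : w = fun t => (- (1 + b)^-1) * (2 * u (t - 1) + a * W t)); last first.
  by apply/funext => t; rewrite /w; ring.
apply/lint2Z/lint2D/lint2Z/continuous_lint2/cW.
exact/(lint2Z 2)/(lint2_shift (-1)).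
Qed.

Let lu2 : lint (fun s => u s ^+ 2). Proof. exact: lu.2. Qed.

Let lw2 : lint (fun s => w s ^+ 2). Proof. exact: lw.2. Qed.

Let cW2 : continuous (fun t => W t ^+ 2).
Proof. by move=> t; apply: cvgM; exact: cW. Qed.

(** Both sides agree at 0, and on [t >= 0] both are primitives of [u (t + 1) - u (t - 1)], which
    equals [w t] by the delay equation. *)
Lemma primitive_jump (t : R) : 0 <= t -> W t = sint u (t - 1) (t + 1).
Proof.
move=> t0.
have l := lint2_lint lu.
suff : W t - W 0 = sint u 1 (t + 1) - sint u (-1) (t - 1).
  rewrite W0 -(@sint_chasles _ u (t - 1) (-1) (t + 1))//.
  rewrite -(@sint_chasles _ u (-1) 1 (t + 1))// (sintC u (-1) (t - 1)); lra.
have -> : sint u 1 (t + 1) = sint (fun s => u (s + 1)) 0 t by rewrite sint_shift// add0r.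
have -> : sint u (-1) (t - 1) = sint (fun s => u (s - 1)) 0 t.
  by rewrite (sint_shift _ _ (-1))// add0r.
rewrite -sintB; [|exact: lint_shift|exact: (lint_shift (-1))].
rewrite pW; apply: eq_sint => // s /andP[s0 _].
apply: (mulfI b1); rewrite wE mulrBr uW//; ring.
Qed.

(* [u (t + 1) ^ 2 - u (t - 1) ^ 2 = - w t * (b * w t + a * W t)] and [w = W'],
   so that [sint u^2 (t - 1) (t + 1) + a * W t ^ 2 / 2] decreases at rate
   [b * w t ^ 2]. *)
Let C0 := (sint (fun s => u s ^+ 2) (- 1) 1 + a * W 0 ^+ 2 / 2) / b.

Let energy (T : R) : 0 <= T -> sint (fun s => w s ^+ 2) 0 T <= C0.
Proof.
move=> T0; rewrite ler_pdivlMr// mulrC.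
have pWW := primitiveM (lint2_lint lw) (lint2_lint lw) pW pW.
have lWw : lint (fun x => w x * W x + W x * w x).
  apply: lintD; first exact/lintMc/cW/lint2_lint.
  by have := lintMc (lint2_lint lw) cW; congr lint; apply/funext => s; rewrite mulrC.
have lm : lint (fun s => u (s - 1) ^+ 2) by exact: (lint_shift (-1) lu2).
have lp : lint (fun s => u (s + 1) ^+ 2) by exact: (lint_shift 1 lu2).
rewrite -sintZ//.
have -> : sint (fun s => b * w s ^+ 2) 0 T = sint (fun s =>
    (u (s - 1) ^+ 2 - u (s + 1) ^+ 2) - a / 2 * (w s * W s + W s * w s)) 0 T.
  apply: eq_sint => // s /andP[s0 _].
  have E1 : u (s + 1) = u (s - 1) + w s.
    by apply: (mulfI b1); rewrite mulrDr wE uW//; ring.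
  have E2 : 2 * u (s - 1) = - (1 + b) * w s - a * W s by rewrite mulNr wE; ring.
  rewrite E1.
  transitivity (- (w s * (2 * u (s - 1) + w s)) - a * (W s * w s)); last by field.
  by rewrite E2; ring.
rewrite (sintB _ _ (lintB lm lp) (lintZ (a / 2) lWw)) (sintB _ _ lm lp) (sintZ (a / 2) _ _ lWw).
rewrite -pWW (sint_shift 0 T (-1) lu2) (sint_shift 0 T 1 lu2) !add0r.
have ch1 := sint_chasles (-1) (T - 1) (T + 1) lu2.
have ch2 := sint_chasles (-1) 1 (T + 1) lu2.
have le : T - 1 <= T + 1 by rewrite lerD2l; lra.
have p1 : 0 <= sint (fun s => u s ^+ 2) (T - 1) (T + 1).
  by apply: sint_ge0 => // s _; exact: sqr_ge0.
have := mulr_ge0 (ltW a0) (sqr_ge0 (W T)).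
lra.
Qed.

Let C := (1 + b) ^+ 2 + 4 * a ^+ 2.

(* Integrating [(1 + b) * w = - 2 * u (. - 1) - a * W] over [T, T + 2] gives
   [2 * W T + a * sint W T (T + 2) = - (1 + b) * (W (T + 2) - W T)], where [W]
   stays close to [W T] when the integral of [w ^ 2] is small. *)
Let jump_bound (T : R) : 0 <= T ->
  W T ^+ 2 <= C * sint (fun s => w s ^+ 2) T (T + 2).
Proof.
move=> T0; set D := sint _ _ _.
have TT : T <= T + 2 by rewrite lerDl.
have D0 : 0 <= D by apply: sint_ge0 => // s _; exact: sqr_ge0.
have dW s : T <= s <= T + 2 -> (W s - W T) ^+ 2 <= 2 * D.
  move=> /andP[Ts sT]; rewrite pW; apply: (le_trans (cauchy_sint lw Ts)).
  have : sint (fun s => w s ^+ 2) T s <= D by apply: sint_sub => // x; exact: sqr_ge0.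
  have : 0 <= sint (fun s => w s ^+ 2) T s.
    by apply: sint_ge0 => // x _; exact: sqr_ge0.
  by move: (sint _ _ _) => y; nra.
have cV : continuous (fun s => W s - W T).
  by move=> s; apply: cvgB; [exact: cW|exact: cvg_cst].
have V2 : sint (fun s => W s - W T) T (T + 2) ^+ 2 <= 8 * D.
  apply: (le_trans (cauchy_sint (continuous_lint2 cV) TT)).
  have -> : T + 2 - T = 2 by ring.
  suff : sint (fun s => (W s - W T) ^+ 2) T (T + 2) <= 4 * D by lra.
  have -> : 4 * D = sint (cst (2 * D)) T (T + 2) by rewrite sint_cst; ring.
  by apply: le_sint => //; [exact: (continuous_lint2 cV).2|exact: lint_cst].
have E : (2 + 2 * a) * W T =
    - (1 + b) * (W (T + 2) - W T) - a * sint (fun s => W s - W T) T (T + 2).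
  have lW := continuous_lint cW.
  have ls : lint (fun s => u (s - 1)) by exact/(lint_shift (-1))/lint2_lint.
  rewrite (sintB _ _ lW (lint_cst (W T))) sint_cst pW mulNr -sintZ; last exact: lint2_lint.
  have -> : sint (fun s => (1 + b) * w s) T (T + 2) =
      sint (fun s => - (2 * u (s - 1)) - a * W s) T (T + 2).
    by apply: eq_sint => // s _; rewrite wE; ring.
  rewrite (sintB _ _ (lintN (lintZ 2 ls)) (lintZ a lW)) (sintN _ _ (lintZ 2 ls)).
  rewrite (sintZ 2 _ _ ls) (sintZ a _ _ lW) (sint_shift _ _ (-1)); last exact: lint2_lint.
  rewrite [in LHS]mulrDl primitive_jump//.
  have -> : T + 2 - 1 = T + 1 by ring.
  by rewrite -primitive_jump//; ring.
have h1 : (W (T + 2) - W T) ^+ 2 <= 2 * D by apply: dW; rewrite TT lexx.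
have alg (x v y : R) : (2 + 2 * a) * x = - (1 + b) * v - a * y ->
    v ^+ 2 <= 2 * D -> y ^+ 2 <= 8 * D -> x ^+ 2 <= C * D.
  move=> xE v2 y2.
  have le4 : 4 * x ^+ 2 <= ((2 + 2 * a) * x) ^+ 2.
    rewrite exprMn ler_wpM2r ?sqr_ge0//; have := a0; nra.
  have le2 : (- (1 + b) * v - a * y) ^+ 2 <= 2 * (1 + b) ^+ 2 * v ^+ 2 + 2 * a ^+ 2 * y ^+ 2.
    by have := sqr_ge0 ((1 + b) * v - a * y); nra.
  have := ler_wpM2l (sqr_ge0 (1 + b)) v2; have := ler_wpM2l (sqr_ge0 a) y2.
  by rewrite /C; rewrite xE in le4; lra.
exact: alg E h1 V2.
Qed.

(** Integrating [jump_bound] over [0, T] produces the integral of [G (t + 2) - G t], which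
    telescopes to the integral of [G] over [T, T + 2] minus that over [0, 2]. Since [0 <= G <= C0]
    on nonnegative times, it is at most [2 * C0], independently of [T]. *)
Let W_square_bound (T : R) : 0 <= T -> sint (fun s => W s ^+ 2) 0 T <= C * (2 * C0).
Proof.
move=> T0; pose G := sint (fun s => w s ^+ 2) 0.
have cG : continuous G by exact: continuous_sint.
have cG2 : continuous (fun t : R => G (t + 2)).
  move=> t; apply: (@continuous_comp _ _ _ (fun t : R => t + 2) G); last exact: cG.
  by apply: cvgD; [exact: cvg_id|exact: cvg_cst].
have lG := continuous_lint cG; have lG2 := continuous_lint cG2.
have CC0 : 0 <= C.
  by apply: addr_ge0; [exact: sqr_ge0|apply: mulr_ge0 => //; exact: sqr_ge0].
apply: (@le_trans _ _ (sint (fun t => C * (G (t + 2) - G t)) 0 T)).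
  apply: le_sint => //; [exact: continuous_lint|exact/lintZ/lintB|].
  move=> t /andP[t0 _]; rewrite (_ : G (t + 2) - G t = sint (fun s => w s ^+ 2) t (t + 2)).
    exact: jump_bound.
  by rewrite /G -(sint_chasles 0 t (t + 2) lw2); ring.
rewrite (sintZ C _ _ (lintB lG2 lG)) ler_wpM2l// (sintB _ _ lG2 lG).
rewrite (sint_shift _ _ 2 lG) add0r.
have ch1 := sint_chasles 0 2 (T + 2) lG.
have ch2 := sint_chasles 0 T (T + 2) lG.
have p1 : 0 <= sint G 0 2.
  by apply: sint_ge0 => // s /andP[s0 _]; apply: sint_ge0 => // x _; exact: sqr_ge0.
have : sint G T (T + 2) <= 2 * C0.
  have -> : 2 * C0 = sint (cst C0) T (T + 2) by rewrite sint_cst; ring.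
  apply: le_sint => //; [exact: lint_cst|by rewrite lerDl|].
  by move=> s /andP[Ts _]; apply: energy; exact: le_trans Ts.
lra.
Qed.

Lemma delay_finite_energy : (\int[mu]_x (u x ^+ 2)%:E < +oo)%E.
Proof.
(* From [2 * u (s - 1) = - (1 + b) * w s - a * W s] one gets [u (s - 1) ^ 2 <= ((1 + b) ^ 2 * w s ^
   2 + a ^ 2 * W s ^ 2) / 2]; [M] inserts the bounds on the integrals of [w ^ 2] and [W ^ 2]. *)
pose M := ((1 + b) ^+ 2 * C0 + a ^+ 2 * (C * (2 * C0))) / 2.
apply: (@le_lt_trans _ _ M%:E); last exact: ltry.
apply: bounded_sint_integral => // [x|n]; first exact: sqr_ge0.
have n0 : 0 <= n%:R :> R by [].
have n10 : 0 <= n%:R + 1 :> R by rewrite addr_ge0.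
(* The enlarged interval reaches -1 even for [n = 0]. Below -1 nothing is left, and the remainder
   [-1, n] is [0, n + 1] shifted by 1. *)
apply: (@le_trans _ _ (sint (fun x => u x ^+ 2) (- (n%:R + 1)) n%:R)).
  apply: sint_sub => //; first by move=> x; exact: sqr_ge0.
    by rewrite lerN2 lerDl.
  by rewrite (@le_trans _ _ 0)// oppr_le0.
rewrite -(sint_chasles _ (- 1) _ lu2).
have -> : sint (fun x => u x ^+ 2) (- (n%:R + 1)) (- 1) = 0.
  rewrite (@eq_sint_oo _ (cst 0))//; first by rewrite sint_cst mul0r.
  - exact: lint_cst.
  - by rewrite lerN2 lerDr.
  - by move=> x /andP[_ x1] /=; rewrite u_lt// expr0n.
rewrite add0r.
have lm : lint (fun s => u (s - 1) ^+ 2) by exact: (lint_shift (-1) lu2).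
have -> : sint (fun x => u x ^+ 2) (- 1) n%:R = sint (fun s => u (s - 1) ^+ 2) 0 (n%:R + 1).
  by rewrite (sint_shift _ _ (-1) lu2) add0r addrK.
have lW2 := continuous_lint cW2.
apply: (@le_trans _ _ (sint (fun s => (1 + b) ^+ 2 / 2 * w s ^+ 2 + a ^+ 2 / 2 * W s ^+ 2) 0 (n%:R + 1))).
  apply: le_sint => //; first by apply: lintD; exact: lintZ.
  move=> s _; have E2 : u (s - 1) = (- (1 + b) * w s - a * W s) / 2.
    by rewrite mulNr wE; field.
  by rewrite E2; have := sqr_ge0 ((1 + b) * w s - a * W s); lra.
rewrite (sintD _ _ (lintZ _ lw2) (lintZ _ lW2)) (sintZ _ _ _ lw2) (sintZ _ _ _ lW2).
have := ler_wpM2l (sqr_ge0 (1 + b)) (energy n10).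
have := ler_wpM2l (sqr_ge0 a) (W_square_bound n10).
rewrite /M; lra.
Qed.

End Energy.

(** * Square integrals and translations *)

Definition sqn {R : realType} (D : set R) (f : R -> R) : \bar R :=
  (\int[@lebesgue_measure R]_(x in D) (f x ^+ 2)%:E)%E.

Section SquareIntegral.
Context {R : realType}.
Local Notation mu := (@lebesgue_measure R).
Implicit Types (f g u v : R -> R) (D E : set R).

Lemma cvge0P {T : Type} (F : set_system T) {FF : Filter F} (f : T -> \bar R) :
  (forall t, (0 <= f t)%E) ->
  (f t @[t --> F] --> 0%E) <->
  (forall e : R, 0 < e -> \forall t \near F, (f t <= e%:E)%E).
Proof.
move=> f0; split.
  move=> /fine_cvgP[ffin /cvgrPdist_le H] e /H.
  apply: filterS2 ffin => t ft; rewrite sub0r normrN /= => fe.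
  rewrite -(fineK ft) lee_fin; apply: le_trans fe; exact: ler_norm.
move=> H; apply/fine_cvgP; split.
  apply: filterS (H 1 ltr01) => t ft.
  by rewrite ge0_fin_numE// (le_lt_trans ft)// ltry.
apply/cvgrPdist_le => e /H; apply: filterS => t ft /=.
rewrite sub0r normrN ger0_norm ?fine_ge0// -lee_fin fineK//.
by rewrite ge0_fin_numE// (le_lt_trans ft)// ltry.
Qed.

Lemma sqn_ge0 D f : (0 <= sqn D f)%E.
Proof. by apply: integral_ge0 => x _; rewrite lee_fin sqr_ge0. Qed.

Lemma measurable_sqr D f : measurable_fun D f ->
  measurable_fun D (fun x => (f x ^+ 2)%:E).
Proof. by move=> mf; apply/measurable_EFinP; exact: measurable_funX. Qed.

Lemma sub_sqn D E f : measurable D -> measurable E -> measurable_fun E f ->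
  D `<=` E -> (sqn D f <= sqn E f)%E.
Proof.
move=> mD mE mf DE; apply: ge0_subset_integral => //; first exact: measurable_sqr.
by move=> x _; rewrite lee_fin sqr_ge0.
Qed.

Lemma sqnD D f g : measurable D -> measurable_fun D f -> measurable_fun D g ->
  (sqn D (fun x => f x + g x)%R <= 2%:E * sqn D f + 2%:E * sqn D g)%E.
Proof.
move=> mD mf mg.
have s0 (h : R -> R) x : D x -> (0 <= (h x ^+ 2)%:E)%E by rewrite lee_fin sqr_ge0.
have c0 (h : R -> R) x : D x -> (0 <= 2%:E * (h x ^+ 2)%:E)%E.
  by move=> Dx; apply: mule_ge0; [rewrite lee_fin|exact: s0].
rewrite -!ge0_integralZl_EFin//; try exact: s0; try exact: measurable_sqr.
have m2 (h : R -> R) : measurable_fun D h ->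
    measurable_fun D (fun x => 2%:E * (h x ^+ 2)%:E)%E.
  by move=> mh; apply: emeasurable_funM => //; exact: measurable_sqr.
rewrite -ge0_integralD//; try exact: c0; try exact: m2.
apply: ge0_le_integral => //.
- exact: (s0 (fun x => f x + g x)).
- by apply: measurable_sqr; exact: measurable_funD.
- by apply: emeasurable_funD; exact: m2.
- move=> x _; rewrite -!EFinM -EFinD lee_fin; have := sqr_ge0 (f x - g x); lra.
Qed.

Lemma sqnN D f : sqn D (fun x => - f x) = sqn D f.
Proof. by apply: eq_integral => x _; rewrite sqrrN. Qed.

Lemma sqnB D f g : measurable D -> measurable_fun D f -> measurable_fun D g ->
  (sqn D (fun x => f x - g x)%R <= 2%:E * sqn D f + 2%:E * sqn D g)%E.
Proof.
move=> mD mf mg; rewrite -(sqnN D g); apply: (@sqnD D f (fun x => - g x)) => //.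
exact: measurableT_comp.
Qed.

Lemma sqn_shift f c : measurable_fun setT f ->
  sqn setT (fun x => f (x + c)) = sqn setT f.
Proof.
move=> mf; exact: (integral_shiftT c (measurable_sqr mf)).
Qed.

Lemma sqn_lint2 f : measurable_fun setT f -> (sqn setT f < +oo)%E -> lint2 f.
Proof.
move=> mf foo; split => // a b.
apply: (@integrableS _ _ _ mu setT) => //.
apply/integrableP; split; first exact: measurable_sqr.
apply: le_lt_trans foo; rewrite le_eqVlt; apply/orP; left; apply/eqP.
by apply: eq_integral => x _ /=; rewrite ger0_norm// sqr_ge0.
Qed.

(** Heine's theorem: joint continuity of [g (x + h) - g x] at each [(x, 0)] and compactness of
    [a, b] give a neighbourhood of [h = 0] common to all [x]. *)
Lemma near_uniform_continuous (g : R -> R) (a b e : R) : continuous g -> 0 < e ->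
  \forall h \near (0 : R), forall x, a <= x <= b -> `|g (x + h) - g x| <= e.
Proof.
move=> cg e0.
have /compact_near_coveringP K := @segment_compact R a b.
have FF : Filter (nbhs (0 : R)) by exact: nbhs_filter.
have {}K := K R (nbhs (0 : R)) (fun h x => `|g (x + h) - g x| <= e) FF.
apply: filterS (K _) => [h hx x xab|x _]; first by apply: hx; rewrite /= in_itv.
have c2 : (fun z : R * R => g (z.1 + z.2) - g z.1) z @[z --> (x, (0 : R))] --> (0 : R).
  rewrite -[X in _ --> X](subrr (g x)); apply: cvgB.
    rewrite -[x in g x]addr0.
    apply: (@cvg_comp _ _ _ (fun z : R * R => z.1 + z.2) g _ (nbhs (x + 0))); last exact: cg.
    by apply: (@cvgD _ _ _ _ _ fst snd); [exact: cvg_fst|exact: cvg_snd].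
  by apply: (@cvg_comp _ _ _ (fun z : R * R => z.1) g _ (nbhs x)); [exact: cvg_fst|exact: cg].
move/cvgrPdist_le : c2 => /(_ e e0).
by apply: filterS => -[y h] /=; rewrite sub0r normrN.
Qed.

End SquareIntegral.

(** * Continuity of translations in L^2 and convergence of difference quotients *)

Section Translation.
Context {R : realType}.
Local Notation mu := (@lebesgue_measure R).
Implicit Types (f g u v : R -> R) (D E : set R).

(** Since [|v (x + h) - v x| <= 2 * M], the squared error is at most [2 * M] times the L^1 error, so
    that approximation of [v] in L^1 by a continuous function suffices. *)
Lemma sqn_translation_bounded v (M e : R) : 0 < M -> 0 < e ->
  measurable_fun setT v -> (forall x, `|v x| <= M) ->
  (forall x, M < `|x| -> v x = 0) ->
  \forall h \near (0 : R), (sqn setT (fun x => v (x + h) - v x)%R <= e%:E)%E.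
Proof.
move=> M0 e0 mv vM v0.
have lv : lint v by apply: measurable_lint => // a b; exists M => x _.
(* For [|h| <= 1], both [v x] and [v (x + h)] vanish for [x] outside [-A, A], and [x + h] stays in
   [-B, B] for [x] in [-A, A]. *)
pose A := M + 1; pose B := M + 2.
have [A0 B0 AB] : [/\ 0 < A, 0 < B & B = A + 1] by rewrite /A /B; split; lra.
have AA : - A <= A by lra.
(* [eta] and [eta2] below are such that [2 * M * (eta + 2 * A * eta2 + eta) = e]: two approximation
   errors and the oscillation of [g] over an interval of length [2 * A]. *)
pose eta := e / (8 * M).
have eta0 : 0 < eta by rewrite divr_gt0// mulr_gt0.
have [g_ [cg_ ig_ g_v]] : exists g_ : (R -> R)^nat,
  [/\ forall n, continuous (g_ n),
        forall n, mu.-integrable `[- B, B] (EFin \o g_ n) &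
        (\int[mu]_(z in `[(- B)%R, B]) `|(v z - g_ n z)%:E| @[n --> \oo] --> 0)%E].
  have muB : (@lebesgue_measure R `[(- B)%R, B]%classic < +oo)%E.
    by rewrite lebesgue_measure_itv/=; case: ifP => // _; rewrite -EFinD ltry.
  exact: approximation_continuous_integrable.
have [g cg vg] : exists2 g : R -> R, continuous g &
    sint (fun x => `|v x - g x|) (- B) B <= eta.
  move/cvge0P : g_v => /(_ _ eta eta0)[|N _ /(_ N (leqnn N)) HN].
    by move=> n; apply: integral_ge0 => x _; exact: abse_ge0.
  exists (g_ N) => //; rewrite -lee_fin EFin_sint//; last by lra.
  exact/lint_norm/lintB/continuous_lint/cg_.
have lg := continuous_lint cg.
have ld : lint (fun x => `|v x - g x|) by exact/lint_norm/lintB.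
pose eta2 := e / (8 * M * A).
have eta20 : 0 < eta2 by rewrite divr_gt0// !mulr_gt0.
near=> h.
have h1 : `|h| <= 1.
  by near: h; apply: cvgr0_norm_le => //; exact: cvg_id.
have gh : forall x, - A <= x <= A -> `|g (x + h) - g x| <= eta2.
  by near: h; exact: near_uniform_continuous.
have [h1l h1r] : - 1 <= h /\ h <= 1 by move: h1; rewrite ler_norml => /andP.
have lvh : lint (fun x => v (x + h)) by exact: lint_shift.
have lgh : lint (fun x => g (x + h)) by exact: lint_shift.
have ldh : lint (fun x => `|v (x + h) - g (x + h)|) by exact: (lint_shift h ld).
have lgg : lint (fun x => `|g (x + h) - g x|) by exact/lint_norm/lintB.
have lvv : lint (fun x => `|v (x + h) - v x|) by exact/lint_norm/lintB.
have out x : ~ (- A <= x <= A) -> v (x + h) - v x = 0.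
  move=> xA; have xA' : A < `|x| by rewrite ltNge ler_norml; exact/negP.
  rewrite !v0 ?subrr//; first by rewrite (lt_trans _ xA')// ltrDl.
  by have := ler_normB (x + h) h; rewrite addrK; move: xA'; rewrite /A; lra.
have mvv : measurable_fun setT (fun x : R => v (x + h) - v x).
  by apply: measurable_funB => //; exact: measurable_shift.
have -> : sqn setT (fun x => v (x + h) - v x) = (sint (fun x => (v (x + h) - v x) ^+ 2) (- A) A)%:E.
  rewrite EFin_sint//; last first.
    apply: measurable_lint; first exact: measurable_funX.
    move=> a b; exists ((2 * M) ^+ 2) => x _; rewrite ger0_norm ?sqr_ge0//.
    rewrite -(real_normK (num_real _)) lerXn2r ?nnegrE ?mulr_ge0//; first exact: ltW.
    by apply: (le_trans (ler_normB _ _)); have := vM (x + h); have := vM x; lra.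
  rewrite /sqn [RHS]integral_mkcond; apply: eq_integral => x _.
  rewrite patchE; case: ifPn => //; rewrite notin_setE/= in_itv/= => /out ->.
  by rewrite expr0n.
rewrite lee_fin.
apply: (@le_trans _ _ (sint (fun x => (2 * M) * `|v (x + h) - v x|) (- A) A)).
  apply: le_sint => //; last 2 first.
  - exact: lintZ.
  - move=> x _; rewrite -(real_normK (num_real _)) expr2 ler_wpM2r//.
    by apply: (le_trans (ler_normB _ _)); have := vM (x + h); have := vM x; lra.
  - apply: (le_lint _ _ (lintZ (2 * M) lvv)); first exact: measurable_funX.
    move=> x; rewrite ger0_norm ?sqr_ge0// normrM normr_id (ger0_norm (mulr_ge0 _ (ltW M0)))//.
    rewrite -(real_normK (num_real _)) expr2 ler_wpM2r//.
    by apply: (le_trans (ler_normB _ _)); have := vM (x + h); have := vM x; lra.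
rewrite sintZ//.
suff S : sint (fun x => `|v (x + h) - v x|) (- A) A <= eta + 2 * A * eta2 + eta.
  have := ler_wpM2l (mulr_ge0 (ler0n R 2) (ltW M0)) S.
  rewrite (_ : 2 * M * (_ + _ + _) = e); last first.
    by rewrite /eta /eta2; field; rewrite !gt_eqF.
  by [].
apply: (@le_trans _ _ (sint (fun x => (`|v (x + h) - g (x + h)| + `|g (x + h) - g x|)
    + `|v x - g x|) (- A) A)).
  apply: le_sint => //; first exact/lintD/ld/lintD.
  move=> x _; rewrite (distrC (v x)).
  rewrite (_ : v (x + h) - v x = (v (x + h) - g (x + h) + (g (x + h) - g x)) + (g x - v x)); last by ring.
  by apply: (le_trans (ler_normD _ _)); rewrite lerD2r; exact: ler_normD.
rewrite (sintD _ _ (lintD ldh lgg) ld) (sintD _ _ ldh lgg) lerD//; first rewrite lerD//.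
- rewrite (sint_shift _ _ _ ld); apply: le_trans vg.
  by apply: sint_sub => //; lra.
- have -> : 2 * A * eta2 = sint (cst eta2) (- A) A by rewrite sint_cst; ring.
  by apply: le_sint => //; exact: lint_cst.
- by apply: le_trans vg; apply: sint_sub => //; lra.
Unshelve. all: end_near. Qed.

(** Cutting off both the values and the argument gives the boundedness and the bounded support that
    [sqn_translation_bounded] asks for. *)
Let trunc u (n : nat) x := if `|u x| <= n%:R then (if `|x| <= n%:R then u x else 0) else 0.

Let measurable_trunc u n : measurable_fun setT u -> measurable_fun setT (trunc u n).
Proof.
move=> mf.
have mn (h : R -> R) : measurable_fun setT h -> measurable_fun setT (fun x => `|h x|).
  by move=> mh; exact: measurableT_comp.
apply: measurable_fun_ifT => //.
  by apply: measurable_fun_ler => //; exact: mn.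
by apply: measurable_fun_ifT => //; apply: measurable_fun_ler => //; exact: mn.
Qed.

Lemma sqn_trunc u (e : R) : measurable_fun setT u -> (sqn setT u < +oo)%E -> 0 < e ->
  exists n, (sqn setT (fun x => u x - trunc u n x)%R <= e%:E)%E.
Proof.
move=> mf uoo e0.
have c0 : (sqn setT (fun x => u x - trunc u n x)%R @[n --> \oo] --> 0)%E.
  have := @dominated_convergence _ _ _ mu setT measurableT
    (fun n x => ((u x - trunc u n x) ^+ 2)%:E) (cst 0%E) (fun x => (u x ^+ 2)%:E).
  case.
  - by move=> n; apply: measurable_sqr; apply: measurable_funB => //; exact: measurable_trunc.
  - exact: measurable_cst.
  - apply: nearW => x _; apply: cvg_near_cst.
    exists (maxn (Num.truncn `|u x|).+1 (Num.truncn `|x|).+1) => // n /=.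
    rewrite geq_max => /andP[n1 n2].
    rewrite /trunc !ifT ?subrr ?expr0n//.
      by apply: (le_trans (ltW (truncnS_gt _))); rewrite ler_nat.
    by apply: (le_trans (ltW (truncnS_gt _))); rewrite ler_nat.
  - apply/integrableP; split; first exact: measurable_sqr.
    apply: le_lt_trans uoo; rewrite le_eqVlt; apply/orP; left; apply/eqP.
    by apply: eq_integral => x _ /=; rewrite ger0_norm// sqr_ge0.
  - apply: nearW => x n _; rewrite /= lee_fin ger0_norm ?sqr_ge0//.
    rewrite /trunc; case: ifP => _; last by rewrite subr0.
    by case: ifP => _; rewrite ?subr0// subrr expr0n sqr_ge0.
  by move=> _ _; rewrite integral_cst// mul0e.
move/cvge0P : c0 => /(_ _ e e0)[|N _ /(_ N (leqnn N)) HN]; last by exists N.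
by move=> n; exact: sqn_ge0.
Qed.

Lemma sqn_translation u (e : R) : measurable_fun setT u -> (sqn setT u < +oo)%E -> 0 < e ->
  \forall h \near (0 : R), (sqn setT (fun x => u (x + h) - u x)%R <= e%:E)%E.
Proof.
move=> mf uoo e0.
(* Two uses of [(f + g) ^ 2 <= 2 * f ^ 2 + 2 * g ^ 2] are ahead: the increment of [u - v] may cost
   [e / 4], and each of its two terms [e / 16]. *)
have e16 : 0 < e / 16 by rewrite divr_gt0.
have [n un] := sqn_trunc mf uoo e16.
pose v := trunc u n; have mv : measurable_fun setT v := measurable_trunc n mf.
have e4 : 0 < e / 4 by rewrite divr_gt0.
(* The successor keeps the bound positive when [n = 0]. *)
have := @sqn_translation_bounded v n.+1%:R (e / 4) (ltr0Sn R n) e4 mv.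
move=> /(_ _ _)[||d d0 H].
- move=> x; rewrite /v /trunc; case: ifPn => [un'|_]; last by rewrite normr0.
  case: ifPn => _; last by rewrite normr0.
  by rewrite (le_trans un')// ler_nat.
- move=> x nx; rewrite /v /trunc; case: ifPn => // _.
  rewrite ifF//; apply/negbTE; rewrite -ltNge (le_lt_trans _ nx)// ler_nat//.
exists d => // h /H /= vh.
have mc : measurable_fun setT (fun x : R => u x - v x) by exact: measurable_funB.
have mch := measurable_shift h mc.
have mvh : measurable_fun setT (fun x : R => v (x + h) - v x).
  by apply: measurable_funB => //; exact: measurable_shift.
rewrite (_ : (fun x => u (x + h) - u x) = fun x =>
    ((u (x + h) - v (x + h)) - (u x - v x)) + (v (x + h) - v x)); last first.
  by apply/funext => x; ring.
apply: (le_trans (sqnD measurableT (measurable_funB mch mc) mvh)).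
have -> : (e%:E = 2%:E * (e / 4)%:E + 2%:E * (e / 4)%:E)%E.
  by rewrite -EFinM -EFinD; congr EFin; field.
apply: leeD; apply: lee_wpmul2l => //.
apply: (le_trans (sqnB measurableT mch mc)).
rewrite (sqn_shift h mc).
have -> : ((e / 4)%:E = 2%:E * (e / 16)%:E + 2%:E * (e / 16)%:E)%E.
  by rewrite -EFinM -EFinD; congr EFin; field.
by apply: leeD; apply: lee_wpmul2l.
Qed.

Lemma continuous_window u (p q : R) : lint u ->
  continuous (fun x : R => sint u (x + p) (x + q)).
Proof.
move=> lu; rewrite (_ : (fun x => _) = fun x => sint u 0 (x + q) - sint u 0 (x + p)); last first.
  by apply/funext => x; rewrite -(sint_chasles 0 (x + p) (x + q) lu); ring.
have c r : continuous (fun x : R => sint u 0 (x + r)).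
  move=> x; apply: (@continuous_comp _ _ _ (fun x : R => x + r) (sint u 0)).
    by apply: cvgD; [exact: cvg_id|exact: cvg_cst].
  exact: continuous_sint.
by move=> x; apply: cvgB; exact: c.
Qed.

(** For [p = 0] and [q = h] the right-hand side is [h] times the error between the difference
    quotient at [x] of a primitive of [u] and [u x]. *)
Lemma sint_increment u (x p q : R) : lint u ->
  sint (fun r => u (x + r) - u x) p q = sint u (x + p) (x + q) - u x * (q - p).
Proof.
move=> lu.
have E : (fun r => u (x + r)) = (fun r => u (r + x)).
  by apply/funext => r; rewrite addrC.
have lx : lint (fun r => u (x + r)) by rewrite E; exact: lint_shift.
by rewrite (sintB _ _ lx (lint_cst _)) sint_cst E sint_shift// (addrC p) (addrC q).
Qed.

(* Cauchy-Schwarz in [r] and Tonelli reduce the L^2 error of difference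
   quotients to the L^2 modulus of continuity of translations. *)
Lemma sqn_increment u (p q e : R) : measurable_fun setT u -> (sqn setT u < +oo)%E ->
  p <= q -> 0 <= e ->
  (forall r, p <= r <= q -> (sqn setT (fun x => u (x + r) - u x)%R <= e%:E)%E) ->
  (sqn setT (fun x => sint (fun r => u (x + r) - u x) p q)%R <= ((q - p) ^+ 2 * e)%:E)%E.
Proof.
move=> mf uoo pq e0 H.
have lu := sqn_lint2 mf uoo.
have lux x : lint2 (fun r => u (x + r) - u x).
  apply: lint2B; last exact: lint2_cst.
  by have := lint2_shift x lu; congr lint2; apply/funext => r; rewrite addrC.
have qp0 : 0 <= q - p by rewrite subr_ge0.
have mI : measurable `[p, q]%classic by [].
(* The indicator extends the integral in [r] to the whole line, so that Tonelli applies on the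
   plane. *)
pose F (z : R * R) := ((u (z.1 + z.2) - u z.1) ^+ 2 * \1_(`[p, q]%classic) z.2)%:E : \bar R.
have mF : measurable_fun setT F.
  apply/measurable_EFinP; apply: measurable_funM.
    apply: measurable_funX; apply: measurable_funB; apply: measurableT_comp => //.
    exact: measurable_funD.
  by apply: measurableT_comp => //; exact: measurable_indic.
have F0 z : (0 <= F z)%E by rewrite lee_fin mulr_ge0 ?sqr_ge0.
have intF x : (\int[mu]_r F (x, r) = \int[mu]_(r in `[p, q]) ((u (x + r) - u x) ^+ 2)%:E)%E.
  rewrite [RHS]integral_mkcond; apply: eq_integral => r _.
  by rewrite /F patchE indicE; case: ifPn => _; rewrite ?mulr1 ?mulr0.
apply: (@le_trans _ _ (\int[mu]_x ((q - p)%:E * \int[mu]_r F (x, r)))%E).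
  apply: ge0_le_integral => //.
  - by move=> x _; rewrite lee_fin sqr_ge0.
  - apply: measurable_sqr; under eq_fun do rewrite (sint_increment _ _ _ (lint2_lint lu)).
    apply: measurable_funB; last exact: measurable_funM.
    by apply: continuous_measurable_fun; apply: continuous_window; exact: lint2_lint.
  - apply: emeasurable_funM => //; exact: measurable_fun_fubini_tonelli_F.
  - move=> x _; rewrite intF -EFin_sint//; last exact: (lux x).2.
    by rewrite -EFinM lee_fin cauchy_sint.
rewrite ge0_integralZl_EFin//; last 2 first.
- by move=> x _; exact: integral_ge0.
- exact: measurable_fun_fubini_tonelli_F.
rewrite fubini_tonelli// expr2 -mulrA EFinM; apply: lee_wpmul2l; first by rewrite lee_fin.
apply: (@le_trans _ _ (\int[mu]_r ((e * \1_(`[p, q]%classic) r)%:E))%E).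
  apply: ge0_le_integral => //.
  - by move=> r _; exact: integral_ge0.
  - exact: measurable_fun_fubini_tonelli_G.
  - by apply/measurable_EFinP; apply: measurable_funM => //; exact: measurable_indic.
  - move=> r _; rewrite /F indicE; case: (boolP (r \in _)) => [|_].
      rewrite inE/= in_itv/= => /H; rewrite mulr1 => Hr.
      apply: le_trans Hr; rewrite le_eqVlt; apply/orP; left; apply/eqP.
      by apply: eq_integral => x _; rewrite mulr1.
    by rewrite mulr0 integral0_eq// => x _; rewrite mulr0.
under eq_integral do rewrite EFinM.
rewrite ge0_integralZl_EFin//; last exact/measurable_EFinP/measurable_indic.
rewrite integral_indic// setIT mulrC EFinM.
suff muI : (@lebesgue_measure R `[p, q]%classic = (q - p)%:E)%E by rewrite -muI.
rewrite lebesgue_measure_itv/= lte_fin.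
by move: pq; rewrite le_eqVlt => /predU1P[->|->]; rewrite ?ltxx ?subrr.
Qed.

End Translation.

(** * Representatives of H^1 functions *)

Section DefsInterface.
Context {R : realType}.
Local Notation mu := (@lebesgue_measure R).
Implicit Types (f g u v : R -> R) (D E : set R).

Lemma L2normE D f : measurable D -> (L2norm D f ^+ 2)%E = sqn D f.
Proof.
move=> mD; rewrite /sqn [RHS]integral_mkcond.
have -> : (L2norm D f ^+ 2 = L2norm D f `^ 2)%E.
  have := Lnorm_ge0 mu 2%:E (EFin \o (f \_ D)); rewrite -/(L2norm D f).
  case: (L2norm D f) => [r||] //.
    by rewrite lee_fin => r0; rewrite poweR_EFin powR_mulrn// EFin_expe.
  by move=> _; rewrite poweRyr.
rewrite poweR_Lnorm//; apply: eq_integral => x _.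
rewrite /= patchE [in RHS]patchE; case: ifPn => _.
  by rewrite powR_mulrn// real_normK// num_real.
(* Outside [D] the restriction takes the default value [point], which is 0 in [R]. *)
by rewrite [point : R](_ : _ = 0)// normr0 powR0.
Qed.

Lemma L2P D f : measurable D -> L2 D f ->
  measurable_fun setT (f \_ D) /\ (sqn setT (f \_ D) < +oo)%E.
Proof.
move=> mD; rewrite /L2 inE => /andP[/set_mem/= mf /set_mem/= fin]; split => //.
have : (L2norm setT (f \_ D) < +oo)%E.
  rewrite /L2norm (_ : (f \_ D) \_ setT = f \_ D)//.
  by apply/funext => x; rewrite patchE in_setT.
rewrite -L2normE//.
have := Lnorm_ge0 mu 2%:E (EFin \o ((f \_ D) \_ setT)); rewrite -/(L2norm setT (f \_ D)).
by case: (L2norm setT _) => // r r0 _; rewrite -EFin_expe ltry.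
Qed.

Lemma sqn_L2 D f : measurable D -> measurable_fun setT (f \_ D) ->
  (sqn D f < +oo)%E -> L2 D f.
Proof.
move=> mD mf; rewrite -L2normE// => foo.
rewrite /L2 inE; apply/andP; split; first exact/mem_set.
apply/mem_set => /=; rewrite /finite_norm.
have := Lnorm_ge0 mu 2%:E (EFin \o (f \_ D)); move: foo; rewrite /L2norm.
by case: (Lnorm _ _ _) => // r _ _; exact: ltry.
Qed.

Lemma lint2_L2 f a b : lint2 f -> L2 `]a, b[ f.
Proof.
move=> [mf lf]; apply: sqn_L2 => //.
  by apply/(measurable_restrictT _ _).1 => //; exact: measurable_funTS.
apply: (@le_lt_trans _ _ (sqn `[a, b] f)).
  apply: sub_sqn => //; [exact: measurable_funTS|exact: subset_itv_oo_cc].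
have /integrableP[_] := lf a b; apply: le_lt_trans.
rewrite le_eqVlt; apply/orP; left; apply/eqP.
by apply: eq_integral => x _ /=; rewrite ger0_norm// sqr_ge0.
Qed.

Lemma L2norm_cvg0 {T : Type} (F : set_system T) {FF : Filter F} D (f : T -> R -> R) :
  measurable D ->
  (L2norm D (f t) @[t --> F] --> 0%E) <-> (sqn D (f t) @[t --> F] --> 0%E).
Proof.
move=> mD; rewrite !cvge0P; last 2 first.
- by move=> t; exact: sqn_ge0.
- by move=> t; exact: Lnorm_ge0.
have N0 t : (0 <= L2norm D (f t))%E by exact: Lnorm_ge0.
split => H e e0.
- have s0 : 0 < Num.sqrt e by rewrite sqrtr_gt0.
  apply: filterS (H _ s0) => t; rewrite -L2normE//.
  have := N0 t; case: (L2norm D (f t)) => // r; rewrite -EFin_expe !lee_fin => r0 re.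
  by rewrite -(sqr_sqrtr (ltW e0)) lerXn2r ?nnegrE ?sqrtr_ge0.
- apply: filterS (H _ (exprn_gt0 2 e0)) => t; rewrite -L2normE//.
  have := N0 t; case: (L2norm D (f t)) => // r.
  by rewrite -EFin_expe !lee_fin => r0; rewrite ler_pXn2r ?nnegrE// ltW.
Qed.

(** The values of [f] outside ]0, 1[ are arbitrary. Extending it by zero gives a function integrable
    on all bounded intervals, as the lemmas on [sint] require; the endpoints 0 and [x] are
    negligible. *)
Lemma sint_restrict f x : L2 `]0, 1[ f -> 0 <= x <= 1 ->
  \int[mu]_(y in `[0, x]) f y = sint (f \_ `]0, 1[) 0 x.
Proof.
move=> /(L2P (measurable_itv _))[mf foo] /andP[x0 x1].
have lf := lint2_lint (sqn_lint2 mf foo).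
rewrite le_sintE//.
rewrite /Rintegral; congr fine.
apply: eq_integral_itv_bounded.
- have : measurable_fun (`]0, 1[%classic : set R) f by apply/(measurable_restrictT _ _).2.
  by apply: measurable_funS => // y /=; rewrite !in_itv/= => /andP[-> yx]; exact: lt_le_trans yx x1.
- exact: measurable_funTS.
- move=> y; rewrite in_itv/= => /andP[y0 yx].
  by rewrite patchE ifT// inE/= in_itv/= y0 (lt_le_trans yx).
Qed.

Lemma has_derivP f g : has_deriv f g ->
  lint2 (g \_ `]0, 1[) /\
  forall x, 0 <= x <= 1 -> f x = f 0 + sint (g \_ `]0, 1[) 0 x.
Proof.
move=> [g2 fE]; split; first by have [mg goo] := L2P (measurable_itv _) g2; exact: sqn_lint2.
by move=> x x01; rewrite fE// sint_restrict.
Qed.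

Lemma lint2_has_deriv f g : lint2 g ->
  (forall x, 0 <= x <= 1 -> f x = f 0 + sint g 0 x) -> has_deriv f g.
Proof.
move=> lg fE; split; first exact: lint2_L2.
by move=> x x01; rewrite fE// le_sintE//; case/andP: x01.
Qed.

(** By Lebesgue differentiation the primitive of [h] has derivative [h] almost everywhere, while
    here it is locally constant on ]0, 1[. *)
Lemma sint0_ae_eq0 h : lint h -> (forall x, 0 <= x <= 1 -> sint h 0 x = 0) ->
  ae_eq mu (`]0, 1[%classic : set R) h (cst 0).
Proof.
move=> lh h0.
(* Cutting [h] off makes it integrable on the whole line, and its primitive from -oo then coincides
   on [0, 1] with the one from 0. *)
pose k := h \_ `[0, 2].
have ik : mu.-integrable `[0, 2] (EFin \o h) by exact: lh.
have lock : locally_integrable setT k by exact: integrable_locally.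
have ikT : mu.-integrable setT (EFin \o k).
  by rewrite -restrict_EFin; apply/integrable_restrict => //; rewrite setTI.
have iky (y : R) : mu.-integrable `]-oo, y] (EFin \o k).
  exact: integrableS ikT.
have FTC := FTC1Ny iky lock.
rewrite /ae_eq; apply: (@filterS _ _ (ae_filter_ringOfSetsType mu) _ _ _ FTC) => x Hx.
rewrite /= in_itv/= => /andP[x0 x1].
have kx : k x = h x.
  by rewrite /k patchE ifT// inE/= in_itv/= (ltW x0)/= (le_trans (ltW x1))// ler1n.
have [_] := Hx; rewrite kx => <-.
rewrite derive1E (@near_eq_derive _ _ _ _ (cst 0)); first by rewrite derive_cst.
near=> y.
have /andP[y0 y1] : y \in `]0, 1[.
  by near: y; apply: near_in_itvoo; rewrite in_itv/= x0 x1.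
rewrite !bnd_simp in y0 y1.
rewrite -[RHS](h0 y) ?(ltW y0) ?(ltW y1)// le_sintE ?(ltW y0)// -Rintegral_mkcondr.
congr (Rintegral _ _ _); apply/seteqP; split => z /=; rewrite !in_itv/=.
  by case=> zy /andP[-> _].
move=> /andP[z0 zy]; split => //; rewrite z0/=.
by rewrite (le_trans zy)// (le_trans (ltW y1))// ler1n.
Unshelve. all: end_near. Qed.

Lemma weakD_ae f g : has_deriv f g -> has_deriv f (weakD f) /\
  ae_eq mu (`]0, 1[%classic : set R) (weakD f) g.
Proof.
move=> fg; have fw : has_deriv f (weakD f).
  by rewrite /weakD; apply: (@xgetPex _ _ [set g | has_deriv f g]); exists g.
split => //.
have [lg gE] := has_derivP fg; have [lw wE] := has_derivP fw.
have := @sint0_ae_eq0 (fun x => (weakD f \_ `]0, 1[) x - (g \_ `]0, 1[) x).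
move=> /(_ (lintB (lint2_lint lw) (lint2_lint lg))) [|N [mN N0 sub]].
  move=> x x01; rewrite (sintB _ _ (lint2_lint lw) (lint2_lint lg)).
  by have := gE x x01; have := wE x x01; lra.
exists N; split => // x /= /not_implyP[x01 ne]; apply: sub => /= /(_ x01)/eqP.
by rewrite !patchE !ifT ?inE// subr_eq0 => /eqP.
Qed.

Lemma ae_eq_sqn f g : measurable_fun setT (f \_ `]0, 1[) ->
  measurable_fun setT (g \_ `]0, 1[) -> ae_eq mu (`]0, 1[%classic : set R) f g ->
  sqn `]0, 1[ f = sqn `]0, 1[ g.
Proof.
move=> mf mg fg; apply: ae_eq_integral => //.
- by apply: measurable_sqr; apply/(measurable_restrictT _ _).2.
- by apply: measurable_sqr; apply/(measurable_restrictT _ _).2.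
- by apply: filterS fg => x H Dx; rewrite H.
Qed.

(** Applied to the derivative of an H^1 function, this bounds its increments at all points of [0, 1]
    by an L^2 norm; the constant is 1 because the interval has length at most 1. *)
Lemma cauchy_sqn f x y : lint2 f -> 0 <= x -> x <= y -> y <= 1 ->
  ((sint f x y ^+ 2)%:E <= sqn `]0%R, 1%R[ f)%E.
Proof.
move=> lf x0 xy y1.
have -> : sqn `]0, 1[ f = (sint (fun x => f x ^+ 2) 0 1)%:E.
  rewrite EFin_sint//; last exact: lf.2.
  rewrite [RHS]integral_itv_bndoo//.
  by apply: measurable_sqr; apply: measurable_funTS; case: lf.
rewrite lee_fin; apply: (le_trans (cauchy_sint lf xy)).
apply: (@le_trans _ _ (sint (fun x => f x ^+ 2) x y)).
  rewrite ler_piMl//; last lra.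
  by apply: sint_ge0 => // t _; exact: sqr_ge0.
by apply: sint_sub => //; [exact: lf.2|move=> t; exact: sqr_ge0].
Qed.

End DefsInterface.

(** * D'Alembert's solution *)

Lemma has_deriv_eq {R : realType} (f g h : R -> R) :
  has_deriv f g -> (forall x, 0 < x < 1 -> g x = h x) -> has_deriv f h.
Proof.
move=> [g2 fE] gh.
have E : g \_ `]0, 1[ = h \_ `]0, 1[.
  apply/funext => x; rewrite !patchE; case: ifPn => //.
  by rewrite inE/= in_itv/= => /gh.
have h2 : L2 `]0, 1[ h by move: g2; rewrite /L2 E.
by split => // x x01; rewrite fE// !sint_restrict// E.
Qed.

Section DAlembert.
Context {R : realType}.
Local Notation mu := (@lebesgue_measure R).
Local Notation I01 := (`]0%R, 1%R[%classic : set R).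
Variable u : R -> R.
Hypotheses (mu_ : measurable_fun setT u) (u_fin : (sqn setT u < +oo)%E).

Let phi : R -> R := sint u 0.

(* With [y = 1 - x] and [phi] a primitive of [u], this is d'Alembert's solution
   [phi (t + y) - phi (t - y)], which vanishes at [y = 0]. *)
Definition dalembert (t x : R) : R := sint u 0 (t + 1 - x) - sint u 0 (x + (t - 1)).
Definition dalembert_t (t x : R) : R := u (t + 1 - x) - u (x + (t - 1)).
Definition dalembert_x (t x : R) : R := - u (t + 1 - x) - u (x + (t - 1)).

Let lu2 : lint2 u. Proof. exact: sqn_lint2. Qed.
Let lu : lint u. Proof. exact: lint2_lint. Qed.
Let cphi : continuous phi. Proof. exact: continuous_sint. Qed.
Let lphi : lint phi. Proof. exact: continuous_lint. Qed.
Let phiB a b : phi b - phi a = sint u a b.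
Proof. by rewrite /phi -(sint_chasles 0 a b lu); ring. Qed.

Lemma lint2_dalembert_t t : lint2 (dalembert_t t).
Proof. by apply: lint2B; [exact: lint2_reflect|exact: lint2_shift]. Qed.

Lemma lint2_dalembert_x t : lint2 (dalembert_x t).
Proof. by apply: lint2B; [exact/lint2N/lint2_reflect|exact: lint2_shift]. Qed.

Lemma primitive_dalembert t : primitive (dalembert t) (dalembert_x t).
Proof.
move=> x y; rewrite /dalembert_x sintB; [|exact/lintN/lint_reflect|exact: lint_shift].
rewrite sintN; last exact: lint_reflect.
rewrite sint_reflect// sint_shift// -!phiB /dalembert /phi; ring.
Qed.

Lemma has_deriv_dalembert t : has_deriv (dalembert t) (dalembert_x t).
Proof.
apply: lint2_has_deriv; first exact: lint2_dalembert_x.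
by move=> x _; rewrite -primitive_dalembert; ring.
Qed.

Lemma dalembert1 t : dalembert t 1 = 0.
Proof. by rewrite /dalembert addrK addrCA subrr addr0 subrr. Qed.

Lemma H0_dalembert t : H0 (dalembert t) (dalembert_t t).
Proof.
split; last exact/lint2_L2/lint2_dalembert_t.
by split; [exists (dalembert_x t); exact: has_deriv_dalembert|exact: dalembert1].
Qed.

Let omega h := sqn setT (fun x : R => u (x + h) - u x).

(** The space and time derivatives of [dalembert] combine a reflected and a translated copy of one
    function; each copy costs at most the norm on the whole line, and 4 = 2 + 2 comes from the
    square of a sum. *)
Let sqn_refl_shift (f : R -> R) (c d : R) : measurable_fun setT f ->
  (sqn I01 (fun x : R => f (c - x) + f (x + d))%R <= 4%:E * sqn setT f)%E /\
  (sqn I01 (fun x : R => f (c - x) - f (x + d))%R <= 4%:E * sqn setT f)%E.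
Proof.
move=> mf.
have m1 : measurable_fun setT (fun x : R => f (c - x)) by exact: measurable_reflect.
have m2 : measurable_fun setT (fun x : R => f (x + d)) by exact: measurable_shift.
have E1 : (sqn I01 (fun x : R => f (c - x))%R <= sqn setT f)%E.
  rewrite -[leRHS](integral_reflectT c (measurable_sqr mf)).
  exact: (@sub_sqn _ _ setT (fun x => f (c - x))).
have E2 : (sqn I01 (fun x : R => f (x + d))%R <= sqn setT f)%E.
  rewrite -(sqn_shift d mf).
  exact: (@sub_sqn _ _ setT (fun x => f (x + d))).
have E4 : (4%:E * sqn setT f = 2%:E * sqn setT f + 2%:E * sqn setT f)%E.
  by rewrite -ge0_muleDl ?lee_fin// -EFinD; congr (_%:E * _)%E; ring.
rewrite E4; split.
  apply: (le_trans (sqnD _ (measurable_funTS m1) (measurable_funTS m2))) => //.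
  by apply: leeD; apply: lee_wpmul2l; rewrite ?lee_fin.
apply: (le_trans (sqnB _ (measurable_funTS m1) (measurable_funTS m2))) => //.
by apply: leeD; apply: lee_wpmul2l; rewrite ?lee_fin.
Qed.

Let inc h : measurable_fun setT (fun x : R => u (x + h) - u x).
Proof. by apply: measurable_funB => //; exact: measurable_shift. Qed.

Let sqn_dx s t :
  (sqn I01 (fun x : R => dalembert_x s x - dalembert_x t x)%R <= 4%:E * omega (s - t))%E.
Proof.
have [+ _] := sqn_refl_shift (t + 1) (t - 1) (inc (s - t)).
rewrite -sqnN; apply: le_trans; rewrite le_eqVlt; apply/orP; left; apply/eqP.
congr sqn; apply/funext => x; rewrite /dalembert_x.
rewrite (_ : s + 1 - x = t + 1 - x + (s - t)); last by ring.
rewrite (_ : x + (s - 1) = x + (t - 1) + (s - t)); last by ring.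
ring.
Qed.

Let sqn_dt s t :
  (sqn I01 (fun x : R => dalembert_t s x - dalembert_t t x)%R <= 4%:E * omega (s - t))%E.
Proof.
have [_ +] := sqn_refl_shift (t + 1) (t - 1) (inc (s - t)).
apply: le_trans; rewrite le_eqVlt; apply/orP; left; apply/eqP.
congr sqn; apply/funext => x; rewrite /dalembert_t.
rewrite (_ : s + 1 - x = t + 1 - x + (s - t)); last by ring.
rewrite (_ : x + (s - 1) = x + (t - 1) + (s - t)); last by ring.
ring.
Qed.

Let measure01 : mu I01 = 1%E.
Proof.
suff : @lebesgue_measure R `]0, 1[%classic = 1%E by [].
by rewrite lebesgue_measure_itv/= lte_fin ltr01 -EFinB subr0.
Qed.

(** Each of the three terms of the norm costs [4 * omega (s - t)]. The term in the function itself
    is reduced to the one in its derivative because the function vanishes at 1. *)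
Lemma H0sqnorm_dalembert s t :
  (H0sqnorm (dalembert s \- dalembert t)%R (dalembert_t s \- dalembert_t t)%R
   <= 12%:E * omega (s - t))%E.
Proof.
set f := dalembert s \- dalembert t; set d := fun x => dalembert_x s x - dalembert_x t x.
have ld : lint2 d by apply: lint2B; exact: lint2_dalembert_x.
have pd : primitive f d.
  move=> x y; rewrite /d sintB; try exact/lint2_lint/lint2_dalembert_x.
  by rewrite -!primitive_dalembert /f/=; ring.
have hd : has_deriv f d.
  by apply: lint2_has_deriv => // x _; rewrite -pd; ring.
(* [weakD f] is an arbitrary choice of derivative, only known to agree with [d] almost
   everywhere. *)
have [hw wae] := weakD_ae hd.
have wE : sqn I01 (weakD f) = sqn I01 d.
  apply: ae_eq_sqn => //.
    by have [[]] := has_derivP hw.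
  by have [[]] := has_derivP hd.
have f1 : f 1 = 0 by rewrite /f/= !dalembert1 subrr.
have fd : (sqn I01 f <= sqn I01 d)%E.
  apply: (@le_trans _ _ (\int[mu]_(x in I01) sqn I01 d)%E).
    apply: ge0_le_integral => //.
    - by move=> x _; rewrite lee_fin sqr_ge0.
    - apply: measurable_sqr; apply: measurable_funTS; apply: continuous_measurable_fun.
      exact: primitive_continuous (lint2_lint ld) pd.
    - move=> x; rewrite /= in_itv/= => /andP[x0 x1].
      have -> : f x ^+ 2 = sint d x 1 ^+ 2 by rewrite -pd f1 sub0r sqrrN.
      by apply: cauchy_sqn => //; exact: ltW.
  by rewrite integral_cst//= measure01 mule1.
rewrite /H0sqnorm !L2normE// wE.
have W := sqn_dx s t; have V := sqn_dt s t.
have E12 : (12%:E * omega (s - t) = 4%:E * omega (s - t) + 4%:E * omega (s - t)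
    + 4%:E * omega (s - t))%E.
  rewrite -!ge0_muleDl ?lee_fin ?adde_ge0 ?lee_fin//.
  by rewrite -!EFinD; congr (_%:E * _)%E; ring.
by rewrite E12; apply: leeD => //; apply: leeD => //; exact: le_trans fd W.
Qed.

Let near_shift0 (P : R -> Prop) (t : R) (A : set R) :
  (\forall h \near (0 : R), P h) -> \forall s \near within A (nbhs t), P (s - t).
Proof.
move=> /nbhs_ballP[d /= d0 Pd]; apply/nbhs_ballP; exists d => //= s ts As.
apply: Pd; move: ts; rewrite /ball/= sub0r normrN distrC; exact.
Qed.

Lemma continuous_dalembert : continuous_H0 dalembert dalembert_t.
Proof.
split; first by move=> t _; exact: H0_dalembert.
move=> t _; apply/cvge0P.
  move=> s; rewrite /H0sqnorm !L2normE//.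
  by apply: adde_ge0; [apply: adde_ge0|]; exact: sqn_ge0.
move=> e e0; have e12 : 0 < e / 12 by rewrite divr_gt0.
have := near_shift0 t [set s | 0 <= s] (sqn_translation mu_ u_fin e12).
apply: filterS => s om; apply: (le_trans (H0sqnorm_dalembert s t)).
have -> : (e%:E = 12%:E * (e / 12)%:E)%E by rewrite -EFinM; congr EFin; field.
by apply: lee_wpmul2l; rewrite ?lee_fin.
Qed.

(** The error is [1 / h] times the integral of [u (y + r) - u y] over [r] from 0 to [h]. By
    [sqn_increment] its square integral is at most the largest [omega r] with [|r| <= |h|], which is
    small by continuity of translations. *)
Let sqn_quotient (e : R) : 0 < e -> \forall h \near (0 : R), h != 0 ->
  (sqn setT (fun y : R => (phi (y + h) - phi y) / h - u y)%R <= e%:E)%E.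
Proof.
move=> e0.
have /nbhs_ballP[d /= d0 Hd] := sqn_translation mu_ u_fin e0.
apply/nbhs_ballP; exists d => //= h; rewrite /ball/= sub0r normrN => hd h0.
have near_r r : `|r| <= `|h| -> (omega r <= e%:E)%E.
  by move=> rh; apply: Hd; rewrite /ball/= sub0r normrN (le_lt_trans rh).
have pq (p q : R) : p <= q -> (forall r, p <= r <= q -> `|r| <= `|h|) ->
    (q - p) ^+ 2 = h ^+ 2 ->
    (sqn setT (fun x : R => sint (fun r => u (x + r) - u x) p q)%R <= (h ^+ 2 * e)%:E)%E.
  move=> pq H <-; apply: sqn_increment => //; first exact: ltW.
  by move=> r /H/near_r.
have key : (sqn setT (fun x : R => sint (fun r => u (x + r) - u x) 0 h)%R <= (h ^+ 2 * e)%:E)%E.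
  have [h0'|/ltW h0'] := leP 0 h.
    apply: pq => //; last by rewrite subr0.
    by move=> r /andP[r0 rh]; rewrite !ger0_norm.
  rewrite (_ : (fun x => _) = fun x => - sint (fun r => u (x + r) - u x) h 0); last first.
    by apply/funext => x; rewrite sintC.
  rewrite sqnN; apply: pq => //; last by rewrite sub0r sqrrN.
  by move=> r /andP[r0 rh]; rewrite !ler0_norm// lerN2.
have h2 : 0 < h ^+ 2 by rewrite exprn_even_gt0.
have -> : (e%:E = (h ^+ 2)^-1%:E * (h ^+ 2 * e)%:E)%E.
  by rewrite -EFinM; congr EFin; rewrite mulKf// gt_eqF.
apply: (@le_trans _ _ ((h ^+ 2)^-1%:E *
   sqn setT (fun x : R => sint (fun r => u (x + r) - u x) 0 h)%R)%E); last first.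
  by apply: lee_wpmul2l; rewrite ?lee_fin ?invr_ge0 ?(ltW h2).
have mD : measurable_fun setT (fun x : R => sint (fun r => u (x + r) - u x) 0 h).
  under eq_fun do rewrite sint_increment//.
  apply: measurable_funB; last exact: measurable_funM.
  by apply: continuous_measurable_fun; exact: continuous_window.
rewrite -ge0_integralZl_EFin//; last 3 first.
- by move=> x _; rewrite lee_fin sqr_ge0.
- exact: measurable_sqr.
- by rewrite invr_ge0 ltW.
rewrite le_eqVlt; apply/orP; left; apply/eqP; apply: eq_integral => x _.
rewrite -EFinM sint_increment// phiB addr0 subr0; congr EFin; field.
exact: h0.
Qed.

Lemma time_deriv_dalembert : time_deriv dalembert dalembert_t.
Proof.
move=> t _; apply/L2norm_cvg0 => //; apply/cvge0P; first by move=> s; exact: sqn_ge0.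
move=> e e0; have e4 : 0 < e / 4 by rewrite divr_gt0.
have /nbhs_ballP[d /= d0 Hd] := sqn_quotient e4.
suff : nbhs t (fun s => s != t -> 0 <= s -> (sqn I01
    (fun x : R => (dalembert s x - dalembert t x) / (s - t) - dalembert_t t x)%R <= e%:E)%E).
  by [].
apply/nbhs_ballP; exists d => //= s ts st _.
have h0 : s - t != 0 by rewrite subr_eq0.
have {}Hd := Hd (s - t).
have {Hd} : (sqn setT (fun y : R => (phi (y + (s - t)) - phi y) / (s - t) - u y)%R
    <= (e / 4)%:E)%E.
  by apply: Hd h0; move: ts; rewrite /ball/= sub0r normrN distrC.
set q := (fun y : R => _) => Hq.
have mq : measurable_fun setT q.
  apply: measurable_funB => //; apply: measurable_funM => //.
  apply: measurable_funB; last exact: continuous_measurable_fun.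
  by apply: measurable_shift; exact: continuous_measurable_fun.
have [_] := sqn_refl_shift (t + 1) (t - 1) mq.
rewrite (_ : (fun x : R => q (t + 1 - x) - q (x + (t - 1))) =
    (fun x : R => (dalembert s x - dalembert t x) / (s - t) - dalembert_t t x)); last first.
  apply/funext => x; rewrite /q /dalembert /dalembert_t -/phi.
  rewrite (_ : t + 1 - x + (s - t) = s + 1 - x); last by ring.
  rewrite (_ : x + (t - 1) + (s - t) = x + (s - 1)); last by ring.
  ring.
move=> /le_trans; apply.
have -> : (e%:E = 4%:E * (e / 4)%:E)%E by rewrite -EFinM; congr EFin; field.
by apply: lee_wpmul2l; rewrite ?lee_fin.
Qed.

(** The integral of [dalembert_x s x] over [s] in [0, t], in closed form; [phi] being continuous, it
    has values at every point. *)
Definition dalembert_p (t x : R) : R :=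
  - phi (t + 1 - x) + phi (1 - x) - phi (x + (t - 1)) + phi (x + (- 1)).

Lemma time_int_dalembert t x : 0 <= t ->
  time_int dalembert t x = sint phi (1 - x) (t + 1 - x) - sint phi (x - 1) (x + (t - 1)).
Proof.
move=> t0; rewrite /time_int -le_sintE// /dalembert.
rewrite (_ : (fun s => _) = fun s => phi (s + (1 - x)) - phi (s + (x - 1))); last first.
  by apply/funext => s; congr (phi _ - phi _); ring.
rewrite sintB; try exact: lint_shift.
rewrite !sint_shift// !add0r; congr (sint _ _ _ - sint _ _ _); ring.
Qed.

Lemma has_deriv_time_int_dalembert t : 0 <= t ->
  has_deriv (time_int dalembert t) (dalembert_p t).
Proof.
move=> t0.
have l1 := lint_reflect (t + 1) lphi; have l2 := lint_reflect 1 lphi.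
have l3 := lint_shift (t - 1) lphi; have l4 := lint_shift (- 1) lphi.
have k2 := continuous_lint2 cphi.
apply: lint2_has_deriv.
  apply: lint2D; last exact: lint2_shift.
  apply: lint2B; last exact: lint2_shift.
  by apply: lint2D; [exact/lint2N/lint2_reflect|exact: lint2_reflect].
move=> x _; rewrite /dalembert_p.
rewrite (sintD _ _ (lintB (lintD (lintN l1) l2) l3) l4).
rewrite (sintB _ _ (lintD (lintN l1) l2) l3) (sintD _ _ (lintN l1) l2) (sintN _ _ l1).
rewrite !sint_reflect// !sint_shift// !time_int_dalembert//.
pose Phi := sint phi 0.
have PE a b : sint phi a b = Phi b - Phi a.
  by rewrite /Phi -(sint_chasles 0 a b lphi); ring.
by rewrite !PE !add0r !subr0; ring.
Qed.

Lemma has_deriv_dalembert_p t :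
  has_deriv (dalembert_p t) (fun x => dalembert_t t x - dalembert_t 0 x).
Proof.
apply: lint2_has_deriv; first by apply: lint2B; exact: lint2_dalembert_t.
move=> x _.
have ld s := lint2_lint (lint2_dalembert_t s).
rewrite (sintB _ _ (ld t) (ld 0)) /dalembert_t.
rewrite !(sintB _ _ (lint_reflect _ lu) (lint_shift _ lu)).
rewrite !sint_reflect// !sint_shift// -!phiB /dalembert_p.
rewrite !add0r !subr0; ring.
Qed.

Lemma dx_trace_dalembert : has_dx_trace dalembert 1 (fun s => - 2 * u s).
Proof.
move=> t t0; exists (dalembert_p t); split.
- exact: has_deriv_time_int_dalembert.
- by eexists; exact: has_deriv_dalembert_p.
- rewrite -le_sintE// sintZ// -phiB /dalembert_p addrK subrr.
  rewrite (_ : 1 + (t - 1) = t); last by ring.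
  ring.
Qed.

(** The hypothesis is the boundary condition at x = 0, with z_x = - u (t + 1) - u (t - 1) and z_t =
    u (t + 1) - u (t - 1); integrating it over [0, t] gives the form required of mild solutions. *)
Lemma dalembert_wave (a b : R) :
  (forall t, 0 <= t -> - u (t + 1) - u (t - 1) =
     a * dalembert t 0 + b * (u (t + 1) - u (t - 1))) ->
  forall t, 0 <= t ->
  dalembert_p t 0 = a * time_int dalembert t 0 + b * (dalembert t 0 - dalembert 0 0).
Proof.
move=> bc t t0.
have lp := lint_shift 1 lu; have lm := lint_shift (- 1) lu.
have E : dalembert_p t 0 = sint (fun s => - u (s + 1) - u (s + (- 1))) 0 t.
  rewrite (sintB _ _ (lintN lp) lm) (sintN _ _ lp) !sint_shift// -!phiB /dalembert_p.
  by rewrite !add0r !subr0; ring.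
have cd : continuous (fun s => dalembert s 0).
  move=> s; apply: cvgB.
    apply: (@continuous_comp _ _ _ (fun s : R => s + 1 - 0) phi); last exact: cphi.
    by apply: cvgB; [apply: cvgD; [exact: cvg_id|exact: cvg_cst]|exact: cvg_cst].
  apply: (@continuous_comp _ _ _ (fun s : R => 0 + (s - 1)) phi); last exact: cphi.
  by apply: cvgD; [exact: cvg_cst|apply: cvgB; [exact: cvg_id|exact: cvg_cst]].
have ld := continuous_lint cd.
rewrite E /time_int -le_sintE//.
rewrite (_ : dalembert t 0 - dalembert 0 0 = sint (fun s => u (s + 1) - u (s + (- 1))) 0 t).
  rewrite -sintZ// -sintZ; last exact: lintB.
  rewrite -sintD; [|exact: lintZ|exact/lintZ/lintB].
  by apply: eq_sint => // s /andP[s0 _]; exact: bc.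
rewrite (sintB _ _ lp lm) !sint_shift// -!phiB /dalembert -/phi.
by rewrite !add0r !subr0; ring.
Qed.

End DAlembert.

(** * Uniqueness *)

(* Differentiability at [t], one-sided at 0, for the sup norm on [0, 1]. *)
Definition uderiv {R : realType} (f : R -> R -> R) (t : R) (g : R -> R) : Prop :=
  forall e, 0 < e -> exists2 d, 0 < d & forall s, 0 <= s -> `|s - t| < d ->
    forall x, 0 <= x <= 1 -> `|f s x - f t x - (s - t) * g x| <= e * `|s - t|.

(** * Calculus of time derivatives in the sup norm *)

Section UniformDerivative.
Context {R : realType}.
Implicit Types (f g : R -> R) (t : R).

Lemma sint_bound f (a b M : R) : lint f ->
  (forall x, Num.min a b <= x <= Num.max a b -> `|f x| <= M) ->
  `|sint f a b| <= M * `|b - a|.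
Proof.
move=> lf; wlog ab : a b / a <= b.
  move=> H fM; have /orP[ab|ba] := le_total a b; first exact: H.
  rewrite sintC normrN (distrC b a); apply: H => // x.
  by rewrite minC maxC; exact: fM.
rewrite min_l// max_r// => fM; apply: (le_trans (le_normr_sint lf ab)).
rewrite ger0_norm ?subr_ge0// -(sint_cst M).
by apply: le_sint => //; [exact: lint_norm|exact: lint_cst].
Qed.

Lemma uderivD (f1 f2 : R -> R -> R) t g1 g2 : uderiv f1 t g1 -> uderiv f2 t g2 ->
  uderiv (fun s x => f1 s x + f2 s x) t (fun x => g1 x + g2 x).
Proof.
move=> H1 H2 e e0; have e2 : 0 < e / 2 by rewrite divr_gt0.
have [d1 d10 {}H1] := H1 _ e2; have [d2 d20 {}H2] := H2 _ e2.
exists (Num.min d1 d2); first by rewrite lt_min d10.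
move=> s s0; rewrite lt_min => /andP[sd1 sd2] x x01.
have := H1 s s0 sd1 x x01; have := H2 s s0 sd2 x x01.
rewrite (_ : f1 s x + f2 s x - (f1 t x + f2 t x) - (s - t) * (g1 x + g2 x) =
  (f1 s x - f1 t x - (s - t) * g1 x) + (f2 s x - f2 t x - (s - t) * g2 x)); last by ring.
move=> h2 h1; apply: (le_trans (ler_normD _ _)).
by apply: (le_trans (lerD h1 h2)); rewrite -mulrDl -splitr.
Qed.

Lemma uderivZ c (f : R -> R -> R) t g : uderiv f t g ->
  uderiv (fun s x => c * f s x) t (fun x => c * g x).
Proof.
move=> H e e0; have c0 : 0 < `|c| + 1 by rewrite ltr_wpDl.
have [d d0 {}H] := H (e / (`|c| + 1)) (divr_gt0 e0 c0).
exists d => // s s0 sd x x01.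
rewrite (_ : c * f s x - c * f t x - (s - t) * (c * g x) =
  c * (f s x - f t x - (s - t) * g x)); last by ring.
rewrite normrM; apply: (le_trans (ler_wpM2l (normr_ge0 c) (H s s0 sd x x01))).
rewrite mulrA; apply: ler_wpM2r => //.
by rewrite mulrCA ger_pMr// ler_pdivrMr// mul1r lerDl.
Qed.

(** With [r] the error for [f], the error for the square is [(f s x - f t x) ^ 2 + 2 * f t x * r].
    Half of [e] goes to each term: [eta] serves the second, the restriction on [|s - t|] the first,
    where [eta <= 1] gives the Lipschitz constant [G + 1]. *)
Lemma uderiv_sqr (f : R -> R -> R) t g F G :
  (forall x, 0 <= x <= 1 -> `|f t x| <= F) ->
  (forall x, 0 <= x <= 1 -> `|g x| <= G) -> uderiv f t g ->
  uderiv (fun s x => f s x ^+ 2) t (fun x => 2 * (f t x * g x)).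
Proof.
move=> fF gG H e e0.
have F0 : 0 <= F by apply: le_trans (fF 0 _); rewrite ?lexx ?ler01.
have G0 : 0 <= G by apply: le_trans (gG 0 _); rewrite ?lexx ?ler01.
have F1 : 0 < 4 * (F + 1) by rewrite mulr_gt0// ltr_wpDl.
have G1 : 0 < 2 * (G + 1) ^+ 2 by rewrite mulr_gt0// exprn_gt0// ltr_wpDl.
pose eta := Num.min 1 (e / (4 * (F + 1))).
have eta0 : 0 < eta by rewrite lt_min ltr01 divr_gt0.
have [d d0 {}H] := H eta eta0.
exists (Num.min d (e / (2 * (G + 1) ^+ 2))); first by rewrite lt_min d0 divr_gt0.
move=> s s0; rewrite lt_min ltr_pdivlMr// => /andP[sd sG] x x01.
have {H} := H s s0 sd x x01.
set r := _ - (s - t) * g x => Hr.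
have fs : f s x - f t x = (s - t) * g x + r by rewrite /r; ring.
rewrite (_ : _ - _ = (f s x - f t x) ^+ 2 + 2 * f t x * r); last by rewrite /r; ring.
have eta1 : eta <= 1 by rewrite ge_min lexx.
have etaF : eta * (4 * (F + 1)) <= e by rewrite -ler_pdivlMr// ge_min lexx orbT.
set S := `|s - t| in sd sG Hr *; have S0 : 0 <= S by exact: normr_ge0.
have d1 : `|f s x - f t x| <= (G + 1) * S.
  rewrite fs; apply: (le_trans (ler_normD _ _)); rewrite normrM -/S.
  have := ler_wpM2l S0 (gG x x01); have := ler_wpM2r S0 eta1; lra.
have d2 : (f s x - f t x) ^+ 2 <= ((G + 1) * S) ^+ 2.
  rewrite -(real_normK (num_real (f s x - f t x))) lerXn2r ?nnegrE//.
  by rewrite mulr_ge0// addr_ge0.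
apply: (le_trans (ler_normD _ _)); rewrite (ger0_norm (sqr_ge0 _)) !normrM (ger0_norm (ler0n _ 2)).
have d3 : `|f t x| * `|r| <= F * (eta * S).
  by apply: ler_pM => //; exact: fF.
have d4 := ler_wpM2r S0 (ltW sG).
have d5 := ler_wpM2r S0 etaF.
have d6 : 0 <= eta * S by rewrite mulr_ge0// ltW.
have alg (X n1 y z : R) : X <= ((G + 1) * y) ^+ 2 -> n1 <= F * (z * y) ->
    y * (2 * (G + 1) ^+ 2) * y <= e * y -> z * (4 * (F + 1)) * y <= e * y ->
    0 <= z * y -> X + 2 * n1 <= e * y by nra.
by rewrite -mulrA; exact: alg d2 d3 d4 d5 d6.
Qed.

(** Uniformity in [x] is what allows differentiation under the integral sign. *)
Lemma uderiv_sint (f : R -> R -> R) t g : 0 <= t ->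
  (forall s, 0 <= s -> lint (f s)) -> lint g -> uderiv f t g ->
  uderiv (fun s _ => sint (f s) 0 1) t (fun _ => sint g 0 1).
Proof.
move=> t0 lf lg H e e0; have [d d0 {}H] := H e e0.
exists d => // s s0 sd x _.
have ls := lf s s0; have lt := lf t t0.
rewrite -sintZ// -(sintB _ _ ls lt) -(sintB _ _ (lintB ls lt) (lintZ _ lg)).
apply: (le_trans (sint_bound (M := e * `|s - t|) _ _)).
- exact/lintB/lintZ/lg/lintB.
- by rewrite min_l ?max_r// => y y01; exact: H.
- by rewrite subr0 normr1 mulr1.
Qed.

(* A scalar function is viewed as a family of constant functions. *)
Lemma uderiv_le0 (E E' : R -> R) T : 0 <= T ->
  (forall t, 0 <= t -> uderiv (fun s _ => E s) t (fun _ => E' t)) ->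
  (forall t, 0 <= t -> E' t <= 0) -> E T <= E 0.
Proof.
rewrite le_eqVlt => /predU1P[<-//|T0] dE E'0.
have zero01 : 0 <= (0 : R) <= 1 by rewrite lexx ler01.
(* The even extension makes the one-sided continuity at 0 two-sided, as the mean value theorem on
   [0, T] is applied to a function on the whole line. *)
pose N (t : R) := E `|t|.
have cN : continuous N.
  move=> t; apply/cvgrPdist_le => e e0.
  have [d d0 H] := dE `|t| (normr_ge0 _) 1 ltr01.
  have L0 : 0 < `|E' `|t| | + 1 by rewrite ltr_wpDl.
  near=> s.
  have st : `|t - s| < Num.min d (e / (`|E' `|t| | + 1)).
    by near: s; apply: cvgr_dist_lt; [exact: cvg_id|rewrite lt_min d0 divr_gt0].
  move: st; rewrite lt_min ltr_pdivlMr// => /andP[st1 st2].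
  have dd : `| `|s| - `|t| | <= `|t - s| by rewrite distrC; exact: ler_dist_dist.
  have {H} := H `|s| (normr_ge0 _) (le_lt_trans dd st1) 0 zero01.
  rewrite mul1r => H; rewrite /N (distrC (E `|t|)).
  rewrite (_ : E `|s| - E `|t| = (E `|s| - E `|t| - (`|s| - `|t|) * E' `|t|) +
    (`|s| - `|t|) * E' `|t|); last by ring.
  apply: (le_trans (ler_normD _ _)); rewrite normrM.
  have := ler_wpM2r (ltW L0) dd; lra.
have [||c] := @MVT R N E' 0 T T0.
- move=> t; rewrite in_itv/= => /andP[t0 tT].
  suff L : (fun h => h^-1 *: ((N \o shift t) (h *: (1 : R)) - N t)) @ 0^' --> E' t.
    by apply: DeriveDef; [apply/cvg_ex; exists (E' t)|exact: cvg_lim].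
  apply/cvgrPdist_le => e e0.
  have [d d0 H] := dE t (ltW t0) e e0.
  near=> h.
  have h0 : h != 0 by near: h; exact: nbhs_dnbhs_neq.
  have : `|h| < Num.min d t.
    by near: h; apply: dnbhs0_lt; rewrite lt_min d0.
  rewrite lt_min => /andP[hd ht].
  have th0 : 0 <= h + t by move: ht; rewrite ltr_norml => /andP[]; lra.
  have := H (h + t) th0; rewrite addrK => /(_ hd 0 zero01) {}H.
  rewrite /= /GRing.scale/= mulr1 /N (ger0_norm th0) (ger0_norm (ltW t0)).
  rewrite (_ : E' t - h^-1 * (E (h + t) - E t) =
    - (h^-1 * (E (h + t) - E t - h * E' t))); last by field.
  by rewrite normrN normrM normfV mulrC ler_pdivrMr ?normr_gt0.
- exact: continuous_subspaceT.
rewrite in_itv/= => /andP[c0 cT]; rewrite /N normr0 (ger0_norm (ltW T0)) subr0 => EE.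
have := mulr_le0_ge0 (E'0 c (ltW c0)) (ltW T0); rewrite -EE; lra.
Unshelve. all: end_near. Qed.

End UniformDerivative.

(** * The energy argument for zero initial data *)

Section ZeroData.
Context {R : realType}.

Lemma continuous_bounded01 (f : R -> R) : continuous f ->
  exists M, forall x, 0 <= x <= 1 -> `|f x| <= M.
Proof.
move=> cf; have /compact_bounded[M [_ HM]] : compact (f @` `[0, 1]%classic).
  by apply: continuous_compact; [exact: continuous_subspaceT|exact: segment_compact].
exists (M + 1) => x x01; apply: (HM (M + 1)); first by rewrite ltrDl.
by exists x => //=; rewrite in_itv.
Qed.

Lemma uderiv_upper (f : R -> R -> R) t : 0 <= t ->
  (forall x, 0 <= x <= 1 -> lint (fun r => f r x)) ->
  (forall e, 0 < e -> exists2 d, 0 < d & forall s, 0 <= s -> `|s - t| < d ->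
    forall x, 0 <= x <= 1 -> `|f s x - f t x| <= e) ->
  uderiv (fun s x => sint (fun r => f r x) 0 s) t (f t).
Proof.
move=> t0 lf H e e0; have [d d0 {}H] := H e e0; exists d => // s s0 sd x x01.
have l := lf x x01.
have -> : sint (fun r => f r x) 0 s - sint (fun r => f r x) 0 t = sint (fun r => f r x) t s.
  by rewrite -(sint_chasles 0 t s l); ring.
rewrite mulrC -(sint_cst (f t x) t s).
rewrite -(sintB _ _ l (lint_cst _)); apply: sint_bound; first exact/lintB/lint_cst.
move=> r; rewrite ge_min le_max => rts; apply: H => //.
- by case/andP: rts => /orP[tr|sr] _; [exact: le_trans tr|exact: le_trans sr].
- apply: le_lt_trans sd; case/andP: rts => /orP[] h1 /orP[] h2.
  + by rewrite (_ : r = t) ?subrr ?normr0//; apply/eqP; rewrite eq_le h1 h2.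
  + by rewrite !ger0_norm ?subr_ge0 ?lerD2r// (le_trans h1).
  + by rewrite !ler0_norm ?subr_le0 ?lerN2 ?lerD2r// (le_trans h1).
  + by rewrite (_ : r = s) //; apply/eqP; rewrite eq_le h1 h2.
Qed.

Lemma uderiv_primitive (f : R -> R) t : 0 <= t -> continuous f ->
  uderiv (fun s _ => sint f 0 s) t (fun _ => f t).
Proof.
move=> t0 cf; apply: (@uderiv_upper (fun r _ => f r)) => //.
  by move=> x _; exact: continuous_lint.
move=> e e0; have /cvgrPdist_le/(_ e e0)/nbhs_ballP[d /= d0 H] := cf t.
by exists d => // s _ st x _; rewrite distrC; apply: H; rewrite /ball/= distrC.
Qed.

(** All partial integrals of [f] over [0, 1] vanish, so the derivative of its primitive at [x],
    which is [f x], is zero. *)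
Lemma continuous_sint_eq0 (f : R -> R) x : continuous f -> (forall x, 0 <= f x) ->
  sint f 0 1 = 0 -> 0 <= x <= 1 -> f x = 0.
Proof.
move=> cf f0 s0 x01; have lf := continuous_lint cf.
have sub y w : 0 <= y -> y <= w -> w <= 1 -> sint f y w = 0.
  move=> y0 yw w1; apply/eqP; rewrite eq_le sint_ge0// andbT -s0.
  exact: sint_sub.
apply/eqP; rewrite -normr_le0; apply/ler_addgt0Pr => e e0; rewrite add0r.
case/andP: x01 => x0 x1.
have [d d0 H] := uderiv_primitive x0 cf e0.
have z01 : 0 <= (0 : R) <= 1 by rewrite lexx ler01.
(* A second point of [0, 1] close to [x], on the right when [x <= 1 / 2] and on the left
   otherwise. *)
have [y [y0 y1 yx yd]] : exists y, [/\ 0 <= y, y <= 1, y != x & `|y - x| < d].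
  have [x2|x2] := leP x 2^-1.
    exists (x + Num.min (d / 2) (2^-1)).
    have m0 : 0 < Num.min (d / 2) (2^-1 : R) by rewrite lt_min divr_gt0//=.
    have m2 : Num.min (d / 2) (2^-1 : R) <= 2^-1 by rewrite ge_min lexx orbT.
    have m1 : Num.min (d / 2) (2^-1 : R) <= d / 2 by rewrite ge_min lexx.
    split; [lra|lra|by rewrite -subr_eq0 addrAC subrr add0r gt_eqF|].
    by rewrite addrAC subrr add0r ger0_norm ?ltW//; lra.
  exists (x - Num.min (d / 2) (2^-1)).
  have m0 : 0 < Num.min (d / 2) (2^-1 : R) by rewrite lt_min divr_gt0//=.
  have m2 : Num.min (d / 2) (2^-1 : R) <= 2^-1 by rewrite ge_min lexx orbT.
  have m1 : Num.min (d / 2) (2^-1 : R) <= d / 2 by rewrite ge_min lexx.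
  split; [lra|lra|by rewrite -subr_eq0 addrAC subrr add0r oppr_eq0 gt_eqF|].
  by rewrite addrAC subrr add0r normrN ger0_norm ?ltW//; lra.
have yx0 : 0 < `|y - x| by rewrite normr_gt0 subr_eq0.
have := H y y0 yd 0 z01.
rewrite (sub 0 y)// (sub 0 x)// subrr sub0r normrN normrM mulrC.
by rewrite ler_pM2r.
Qed.

(* [zd] is the difference of two solutions, and [Zi] its time integral.  With
   [Y] the time integral of [Zi . 0] and [Q = a * Y + b * Zi . 0 + int_0^x zd],
   one has [Q_t = Zi_x = P] and [Zi_t = Q_x = zd], so that the derivative of the
   energy [E] is [- 2 * b * Zi t 0 ^ 2 <= 0]. *)
Variables (a b : R) (a0 : 0 < a) (b0 : 0 < b) (zd vd : R -> R -> R).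
Let Zi t x := sint (fun s => zd `|s| x) 0 t.
Let P t x := a * Zi t 0 + b * zd t 0 + sint (vd t) 0 x.
Hypothesis H1 : forall t, 0 <= t -> continuous (zd t).
Hypothesis H1' : forall t, 0 <= t -> lint (vd t).
Hypothesis H2 : forall t, 0 <= t -> forall e, 0 < e -> exists2 d, 0 < d &
  forall s, 0 <= s -> `|s - t| < d ->
  forall x, 0 <= x <= 1 -> `|zd s x - zd t x| <= e.
Hypothesis H3 : forall x, 0 <= x <= 1 -> zd 0 x = 0.
Hypothesis H4 : forall t, 0 <= t -> forall x, 0 <= x <= 1 ->
  Zi t x = Zi t 0 + sint (P t) 0 x.
Hypothesis H5 : forall t, 0 <= t ->
  uderiv (fun s x => sint (zd s) 0 x) t (fun x => sint (vd t) 0 x).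
Hypothesis H6 : forall t, 0 <= t -> zd t 1 = 0.

Let i0 : 0 <= (0 : R) <= 1. Proof. by rewrite lexx ler01. Qed.
Let i1 : 0 <= (1 : R) <= 1. Proof. by rewrite lexx ler01. Qed.

(** The hypotheses only concern nonnegative times. The absolute value in [Zi] extends the integrand
    evenly, making it continuous and thus integrable on every bounded interval. *)
Let cz x : 0 <= x <= 1 -> continuous (fun s : R => zd `|s| x).
Proof.
move=> x01 t; apply/cvgrPdist_le => e e0.
have [d d0 H] := H2 (normr_ge0 t) e0.
near=> s; rewrite distrC; apply: H => //.
apply: (le_lt_trans (ler_dist_dist _ _)); rewrite distrC.
by near: s; apply: cvgr_dist_lt => //; exact: cvg_id.
Unshelve. all: end_near. Qed.

Let dZ t : 0 <= t -> uderiv Zi t (zd t).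
Proof.
move=> t0; rewrite -[in zd t](ger0_norm t0).
apply: (@uderiv_upper (fun r x => zd `|r| x)) => //.
  by move=> x x01; exact/continuous_lint/cz.
move=> e e0; have [d d0 H] := H2 t0 e0; exists d => // s s0 sd x x01.
by rewrite (ger0_norm s0) (ger0_norm t0); exact: H.
Qed.

Let cZ0 : continuous (fun s => Zi s 0).
Proof. exact/continuous_sint/continuous_lint/cz. Qed.

Let Y t := sint (fun s => Zi s 0) 0 t.
Let Q t x := (a * Y t + b * Zi t 0) + sint (zd t) 0 x.
(** By [H4] this is [Zi t x] for [x] in [0, 1], but it is a primitive of [P t] on the whole line. *)
Let Zt t x := Zi t 0 + sint (P t) 0 x.

Let dY t : 0 <= t -> uderiv (fun s _ => Y s) t (fun _ => Zi t 0).
Proof. by move=> t0; exact: (uderiv_primitive t0 cZ0). Qed.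

Let dQ t : 0 <= t -> uderiv Q t (P t).
Proof.
move=> t0; apply: uderivD; last exact: H5.
apply: uderivD; apply: uderivZ; first exact: dY.
move=> e e0; have [d d0 H] := dZ t0 e0.
by exists d => // s s0 sd x _; exact: H.
Qed.

Let dZt t : 0 <= t -> uderiv Zt t (zd t).
Proof.
move=> t0 e e0; have [d d0 H] := dZ t0 e0; exists d => // s s0 sd x x01.
by rewrite /Zt -!H4//; exact: H.
Qed.

Let pQ t : 0 <= t -> primitive (Q t) (zd t).
Proof. by move=> t0; exact/primitive_sint/continuous_lint/H1. Qed.

Let cP t : 0 <= t -> continuous (P t).
Proof.
move=> t0 x; apply: cvgD; first exact: cvg_cst.
exact/continuous_sint/H1'.
Qed.

Let pZt t : 0 <= t -> primitive (Zt t) (P t).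
Proof. by move=> t0; exact/primitive_sint/continuous_lint/cP. Qed.

Let cQ t : 0 <= t -> continuous (Q t).
Proof. by move=> t0; apply: primitive_continuous (pQ t0); exact/continuous_lint/H1. Qed.

Let cZt t : 0 <= t -> continuous (Zt t).
Proof. by move=> t0; apply: primitive_continuous (pZt t0); exact/continuous_lint/cP. Qed.

(** On [0, 1], [Q] and [Zt] are the space and time derivatives of the double time integral of [zd],
    and [Y] is its value at x = 0: this is twice its mechanical energy, boundary spring included. *)
Let E t := sint (fun x => Q t x ^+ 2 + Zt t x ^+ 2) 0 1 + a * Y t ^+ 2.
Let E' t := sint (fun x => 2 * (Q t x * P t x) + 2 * (Zt t x * zd t x)) 0 1
  + a * (2 * (Y t * Zi t 0)).

Let lQ2 t : 0 <= t -> lint (fun x => Q t x ^+ 2).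
Proof. by move=> t0; have [] := continuous_lint2 (cQ t0). Qed.

Let lZ2 t : 0 <= t -> lint (fun x => Zt t x ^+ 2).
Proof. by move=> t0; have [] := continuous_lint2 (cZt t0). Qed.

Let dE t : 0 <= t -> uderiv (fun s _ => E s) t (fun _ => E' t).
Proof.
move=> t0.
have [F1 F1P] := continuous_bounded01 (cQ t0).
have [F2 F2P] := continuous_bounded01 (cZt t0).
have [G1 G1P] := continuous_bounded01 (cP t0).
have [G2 G2P] := continuous_bounded01 (H1 t0).
have l1 : lint (fun x => 2 * (Q t x * P t x)).
  exact/lintZ/(lint2M (continuous_lint2 (cQ t0)))/continuous_lint2/cP.
have l2 : lint (fun x => 2 * (Zt t x * zd t x)).
  exact/lintZ/(lint2M (continuous_lint2 (cZt t0)))/continuous_lint2/H1.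
apply: uderivD.
  apply: (@uderiv_sint _ (fun s x => Q s x ^+ 2 + Zt s x ^+ 2)) => //.
  - by move=> s s0; apply: lintD; [exact: lQ2|exact: lZ2].
  - exact: lintD.
  - apply: uderivD; first exact: uderiv_sqr F1P G1P (dQ t0).
    exact: uderiv_sqr F2P G2P (dZt t0).
apply: uderivZ.
by apply: (@uderiv_sqr _ (fun s _ => Y s) t (fun _ => Zi t 0) `|Y t| `|Zi t 0|) => //; exact: dY.
Qed.

(** The integrand is twice the space derivative of [Q * Zt]. The boundary term vanishes at 1; at 0
    it is [- 2 * (a * Y + b * Zi t 0) * Zi t 0], whose part in [Y] cancels the derivative of
    [a * Y ^ 2]. *)
Let E'_le0 t : 0 <= t -> E' t <= 0.
Proof.
move=> t0.
have pp := primitiveM (continuous_lint (H1 t0)) (continuous_lint (cP t0)) (pQ t0) (pZt t0).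
have Z1 : Zt t 1 = 0.
  rewrite /Zt -H4// /Zi (@eq_sint _ _ (cst 0))// ?sint_cst ?mul0r// => s /andP[s0 _].
  exact: H6.
have Z0 : Zt t 0 = Zi t 0 by rewrite /Zt sintaa addr0.
have Q0 : Q t 0 = a * Y t + b * Zi t 0 by rewrite /Q sintaa addr0.
have := pp 0 1; rewrite Z1 Z0 Q0 mulr0 sub0r => pp01.
have -> : E' t = - (2 * b * Zi t 0 ^+ 2).
  rewrite /E' (_ : (fun x => _) = fun x => 2 * (zd t x * Zt t x + Q t x * P t x)); last first.
    by apply/funext => x; ring.
  rewrite sintZ; last first.
    apply: lintD; first exact: lint2M (continuous_lint2 (H1 t0)) (continuous_lint2 (cZt t0)).
    exact: lint2M (continuous_lint2 (cQ t0)) (continuous_lint2 (cP t0)).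
  by rewrite -pp01; ring.
by rewrite oppr_le0 mulr_ge0 ?sqr_ge0// mulr_ge0// ltW.
Qed.

Let Zi_eq0 t x : 0 <= t -> 0 <= x <= 1 -> Zi t x = 0.
Proof.
move=> t0 x01.
have Zi0 y : Zi 0 y = 0 by rewrite /Zi sintaa.
have ET : E t <= E 0 by exact: uderiv_le0 t0 dE E'_le0.
have E0 : E 0 = 0.
  rewrite /E /Y sintaa expr0n mulr0 addr0.
  rewrite (@eq_sint _ _ (cst 0)) ?sint_cst ?mul0r// => y y01.
  have -> : Zt 0 y = 0 by rewrite /Zt -H4// Zi0.
  rewrite /Q /Y sintaa Zi0 !mulr0 !add0r expr0n addr0.
  rewrite (@eq_sint _ _ (cst 0)) ?sint_cst ?mul0r ?expr0n//; first by case/andP: y01.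
  move=> w /andP[w0 wy]; rewrite H3// w0 (le_trans wy)//; by case/andP: y01.
have lQ := lQ2 t0; have lZ := lZ2 t0.
have Qp : 0 <= sint (fun x => Q t x ^+ 2) 0 1 by apply: sint_ge0 => // y _; exact: sqr_ge0.
have Zp : 0 <= sint (fun x => Zt t x ^+ 2) 0 1 by apply: sint_ge0 => // y _; exact: sqr_ge0.
have Yp : 0 <= a * Y t ^+ 2 by rewrite mulr_ge0 ?sqr_ge0// ltW.
have Zs : sint (fun x => Zt t x ^+ 2) 0 1 = 0.
  have alg (q r y : R) : 0 <= q -> 0 <= r -> 0 <= y -> q + r + y <= 0 -> r = 0 by lra.
  by move: ET; rewrite E0 /E (sintD _ _ lQ lZ); exact: alg Qp Zp Yp.
have cZ2 : continuous (fun x => Zt t x ^+ 2) by move=> y; apply: cvgM; exact: cZt.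
have := continuous_sint_eq0 cZ2 (fun y => sqr_ge0 _) Zs x01.
by move=> /eqP; rewrite sqrf_eq0 /Zt -H4// => /eqP.
Qed.

Lemma zero_data_unique t x : 0 <= t -> 0 <= x <= 1 -> zd t x = 0.
Proof.
move=> t0 x01; apply/eqP; rewrite -normr_le0; apply/ler_addgt0Pr => e e0; rewrite add0r.
have [d d0 H] := dZ t0 e0.
have d20 : 0 < d / 2 by rewrite divr_gt0.
have td : 0 <= t + d / 2 by rewrite addr_ge0// ltW.
have := H (t + d / 2) td; rewrite addrAC subrr add0r (ger0_norm (ltW d20)).
have dd : d / 2 < d by lra.
move=> /(_ dd x x01); rewrite !Zi_eq0// subrr sub0r normrN normrM (ger0_norm (ltW d20)).
by rewrite [leLHS]mulrC ler_pM2r.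
Qed.

End ZeroData.

(** * Mild solutions in a pointwise form suited to the energy argument *)

Section MildSolutionFacts.
Context {R : realType}.
Local Notation mu := (@lebesgue_measure R).
Local Notation hat f := (f \_ `]0, 1[).
Local Notation I01 := (`]0%R, 1%R[%classic : set R).
Implicit Types (f g : R -> R).

Lemma hatE f x : 0 < x < 1 -> (hat f) x = f x.
Proof. by move=> x01; rewrite patchE ifT// inE/= in_itv. Qed.

Lemma hatB f g : hat (fun x => f x - g x) = (fun x => (hat f) x - (hat g) x).
Proof.
apply/funext => x; rewrite !patchE; case: ifP => //.
by rewrite [point : R](_ : _ = 0)// subr0.
Qed.

Lemma lint2_hat f : L2 `]0, 1[ f -> lint2 (hat f).
Proof. by move=> /(L2P (measurable_itv _))[]; exact: sqn_lint2. Qed.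

Lemma has_derivB f1 f2 g1 g2 : has_deriv f1 g1 -> has_deriv f2 g2 ->
  has_deriv (f1 \- f2) (fun x => (hat g1) x - (hat g2) x).
Proof.
move=> /has_derivP[l1 E1] /has_derivP[l2 E2].
apply: lint2_has_deriv; first exact: lint2B.
move=> x x01; rewrite /= (sintB _ _ (lint2_lint l1) (lint2_lint l2)) E1// E2//; ring.
Qed.

(** As [f 1 = 0], each [f x] is minus the integral of the derivative over [x, 1], so continuity in
    the energy space gives continuity uniform in [x]. *)
Lemma sup_le_H0sqnorm f g e : H1R f -> 0 <= e -> (H0sqnorm f g <= (e ^+ 2)%:E)%E ->
  forall x, 0 <= x <= 1 -> `|f x| <= e.
Proof.
move=> [[d fd] f1] e0 fe x /andP[x0 x1].
have [fw _] := weakD_ae fd; have [lw wE] := has_derivP fw.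
have fx : f x = - sint (hat (weakD f)) x 1.
  rewrite (wE x) ?x0//; have := wE 1; rewrite f1 ler01 lexx => /(_ isT) E1.
  by rewrite -(sint_chasles 0 x 1 (lint2_lint lw)) in E1; lra.
have : ((f x ^+ 2)%:E <= (e ^+ 2)%:E)%E.
  apply: le_trans fe; rewrite fx sqrrN; apply: (le_trans (cauchy_sqn lw x0 x1 (lexx _))).
  rewrite /H0sqnorm !L2normE//.
  rewrite (_ : sqn _ (hat (weakD f)) = sqn I01 (weakD f)); last first.
    by apply: eq_integral => y; rewrite inE/= in_itv/= => y01; rewrite hatE.
  apply: (@le_trans _ _ (sqn I01 f + sqn I01 (weakD f))%E).
    by rewrite leeDr// sqn_ge0.
  by rewrite leeDl// sqn_ge0.
by rewrite lee_fin -(real_normK (num_real (f x))) ler_pXn2r ?nnegrE.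
Qed.

Lemma near_within_dist (t : R) (Pr : R -> Prop) :
  (\forall s \near within [set s | 0 <= s] (nbhs t), Pr s) ->
  exists2 d, 0 < d & forall s, 0 <= s -> `|s - t| < d -> Pr s.
Proof.
move=> /nbhs_ballP[d /= d0 H]; exists d => // s s0 st; apply: H => //.
by rewrite /ball/= distrC.
Qed.

Variables (a b : R) (z0 z1 : R -> R) (z v : R -> R -> R).
Hypothesis ms : mild_solution a b z0 z1 z v.

(* [z t] is only meaningful on [0, 1]; [crep t] agrees with it there and is
   continuous on the whole line. *)
Definition crep (t x : R) : R := z t 0 + sint (hat (weakD (z t))) 0 x.

Let zH t : 0 <= t -> H0 (z t) (v t). Proof. exact: (mild_continuous ms).1. Qed.

Let zd t : 0 <= t -> has_deriv (z t) (weakD (z t)).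
Proof. by move=> /zH[[[d fd] _] _]; have [] := weakD_ae fd. Qed.

Lemma crepE t x : 0 <= t -> 0 <= x <= 1 -> crep t x = z t x.
Proof. by move=> t0 x01; have [_ ->] := has_derivP (zd t0). Qed.

Lemma continuous_crep t : 0 <= t -> continuous (crep t).
Proof.
move=> t0 x; apply: cvgD; first exact: cvg_cst.
by apply: continuous_sint; have [/lint2_lint] := has_derivP (zd t0).
Qed.

Lemma crep1 t : 0 <= t -> crep t 1 = 0.
Proof. by move=> t0; rewrite crepE ?ler01 ?lexx//; have [[_ ->]] := zH t0. Qed.

Lemma crep_unif t : 0 <= t -> forall e, 0 < e -> exists2 d, 0 < d &
  forall s, 0 <= s -> `|s - t| < d ->
  forall x, 0 <= x <= 1 -> `|crep s x - crep t x| <= e.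
Proof.
move=> t0 e e0.
have f0 s : (0 <= H0sqnorm (z s \- z t)%R (v s \- v t)%R)%E.
  rewrite /H0sqnorm !L2normE//.
  by apply: adde_ge0; [apply: adde_ge0|]; exact: sqn_ge0.
have [d d0 H] := near_within_dist
  ((cvge0P f0).1 ((mild_continuous ms).2 t t0) _ (exprn_gt0 2 e0)).
exists d => // s s0 sd x x01.
rewrite !crepE//; have := H s s0 sd => /sup_le_H0sqnorm; apply => //; last exact: ltW.
split; last by rewrite /= -!crepE ?ler01 ?lexx// !crep1// subrr.
by eexists; exact: (has_derivB (zd s0) (zd t0)).
Qed.

Lemma continuous_crep_time x : 0 <= x <= 1 -> continuous (fun s : R => crep `|s| x).
Proof.
move=> x01 t; apply/cvgrPdist_le => e e0.
have [d d0 H] := crep_unif (normr_ge0 t) e0.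
near=> s; rewrite distrC; apply: H => //.
apply: (le_lt_trans (ler_dist_dist _ _)); rewrite distrC.
by near: s; apply: cvgr_dist_lt => //; exact: cvg_id.
Unshelve. all: end_near. Qed.

Lemma lint2_v t : 0 <= t -> lint2 (hat (v t)).
Proof. by move=> /zH[_]; exact: lint2_hat. Qed.

(** Integration in [x] upgrades differentiability in L^2 to the sup norm, by Cauchy-Schwarz on
    [0, x]. *)
Lemma uderiv_crep t : 0 <= t ->
  uderiv (fun s x => sint (crep s) 0 x) t (fun x => sint (hat (v t)) 0 x).
Proof.
move=> t0 e e0.
have f0 s : (0 <= sqn I01 (fun x => (z s x - z t x) / (s - t) - v t x)%R)%E.
  exact: sqn_ge0.
have FF : Filter (within [set s : R | 0 <= s] t^') by exact: within_filter.
have H := (@L2norm_cvg0 _ _ _ FF _ _ (measurable_itv _)).1 (mild_time_deriv ms t0).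
have {}H := (@cvge0P _ _ _ FF _ f0).1 H _ (exprn_gt0 2 e0).
pose Pr s := (sqn I01 (fun x : R => (z s x - z t x) / (s - t) - v t x)%R <= (e ^+ 2)%:E)%E.
have {}H : nbhs t (fun s => s != t -> 0 <= s -> Pr s) := H.
have [d d0 {}H] : exists2 d, 0 < d & forall s, 0 <= s -> `|s - t| < d -> s != t -> Pr s.
  apply: (@near_within_dist t (fun s => s != t -> Pr s)).
  suff : nbhs t (fun s => 0 <= s -> s != t -> Pr s) by [].
  by apply: filterS H => s Hs s0 st; exact: Hs.
exists d => // s s0 sd x /andP[x0 x1].
(* The limit defining [time_deriv] is over [s != t]. *)
have [->|st] := eqVneq s t; first by rewrite !subrr mul0r subrr normr0 mulr0.
have {H}Hs := H s s0 sd st.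
have ls := continuous_lint2 (continuous_crep s0); have lt := continuous_lint2 (continuous_crep t0).
have lv := lint2_v t0.
have lw := lint2B (lint2B ls lt) (lint2Z (s - t) lv).
rewrite -(sintZ _ _ _ (lint2_lint lv)) -(sintB _ _ (lint2_lint ls) (lint2_lint lt)).
rewrite -(sintB _ _ (lint2_lint (lint2B ls lt)) (lint2_lint (lint2Z (s - t) lv))).
have : ((sint (fun x => crep s x - crep t x - (s - t) * (hat (v t)) x) 0 x ^+ 2)%:E
    <= ((e * `|s - t|) ^+ 2)%:E)%E.
  apply: (le_trans (cauchy_sqn lw (lexx _) x0 x1)).
  have E : sqn I01 (fun x => crep s x - crep t x - (s - t) * (hat (v t)) x) =
      (((s - t) ^+ 2)%:E * sqn I01 (fun x => (z s x - z t x) / (s - t) - v t x)%R)%E.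
    rewrite -ge0_integralZl_EFin ?sqr_ge0//; last 2 first.
    - by move=> y _; rewrite lee_fin sqr_ge0.
    - apply: measurable_sqr.
      apply: (@eq_measurable_fun _ _ _ _ _ (fun y => (crep s y - crep t y) / (s - t) - (hat (v t)) y)).
        move=> y; rewrite inE/= in_itv/= => /andP[y0 y1]; rewrite hatE ?y0//.
        by rewrite !crepE ?(ltW y0) ?(ltW y1).
      apply: measurable_funTS; apply: measurable_funB; last by case: lv.
      apply: measurable_funM => //; apply: measurable_funB; [by case: ls|by case: lt].
    apply: eq_integral => y; rewrite inE/= in_itv/= => /andP[y0 y1].
    rewrite -EFinM; congr EFin; rewrite hatE ?y0// !crepE ?(ltW y0) ?(ltW y1)//.
    by field; rewrite subr_eq0.
  rewrite E exprMn (mulrC (e ^+ 2)) real_normK ?num_real// [leRHS]EFinM.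
  by apply: lee_wpmul2l => //; rewrite lee_fin sqr_ge0.
rewrite lee_fin -(real_normK (num_real (sint _ _ _))) ler_pXn2r ?nnegrE//.
by rewrite mulr_ge0// ltW.
Qed.

Definition crep_int (t x : R) : R := sint (fun s => crep `|s| x) 0 t.

(** The equation for the space derivative [p] of the time integral is integrated from 0, where the
    boundary condition gives [p 0]. In the difference of two solutions the terms in [z0] and [z1]
    cancel. *)
Lemma crep_wave t x : 0 <= t -> 0 <= x <= 1 -> crep_int t x = crep_int t 0 +
  sint (fun y => a * crep_int t 0 + b * (crep t 0 - z0 0)
     + sint (fun r => (hat (v t)) r - (hat z1) r) 0 y) 0 x.
Proof.
move=> t0 x01; have [p [zp pv p0]] := mild_wave ms t0.
have TE y : 0 <= y <= 1 -> time_int z t y = crep_int t y.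
  move=> y01; rewrite /time_int -le_sintE//; apply: eq_sint => // s /andP[s0 _].
  by rewrite ger0_norm// crepE.
have z01 : 0 <= (0 : R) <= 1 by rewrite lexx ler01.
have [lp pE] := has_derivP zp; have [lq qE] := has_derivP pv.
rewrite -!TE// pE//; congr (_ + _).
have [x0 x1] := andP x01.
have eqh : hat (v t \- z1) = (fun r => (hat (v t)) r - (hat z1) r) by rewrite -hatB.
apply: eq_sint_oo => //; first exact: lint2_lint.
  apply: continuous_lint => y; apply: cvgD; first exact: cvg_cst.
  by apply: continuous_sint; rewrite -eqh; exact: lint2_lint.
move=> y /andP[y0 yx]; rewrite hatE; last by rewrite y0 (lt_le_trans yx).
by rewrite qE ?(ltW y0) ?(le_trans (ltW yx))// p0 TE// crepE// eqh.
Qed.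

Lemma crep0 x : 0 <= x <= 1 -> crep 0 x = z0 x.
Proof. by move=> x01; rewrite crepE// (mild_init0 ms). Qed.

End MildSolutionFacts.

Section Uniqueness.
Context {R : realType}.
Local Notation hat f := (f \_ `]0, 1[).

Lemma mild_solution_unique (a b : R) (z0 z1 : R -> R) (z v z' v' : R -> R -> R) :
  0 < a -> 0 < b -> H0 z0 z1 ->
  mild_solution a b z0 z1 z v -> mild_solution a b z0 z1 z' v' ->
  forall t, 0 <= t -> (forall x, 0 <= x <= 1 -> z' t x = z t x) /\
    ae_eq (@lebesgue_measure R) `]0, 1[%classic (v' t) (v t).
Proof.
move=> a0 b0 hz ms ms'.
have half_sub (p q r e S : R) : `|p| <= e / 2 * S -> `|q| <= e / 2 * S ->
    r = p - q -> `|r| <= e * S.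
  by move=> hp hq ->; apply: (le_trans (ler_normB _ _)); lra.
pose zd t x := crep z' t x - crep z t x.
pose vd t x := (hat (v' t)) x - (hat (v t)) x.
have lvd t : 0 <= t -> lint (vd t).
  by move=> t0; apply: lintB; apply/lint2_lint; [exact: lint2_v ms' _ t0|exact: lint2_v ms _ t0].
have lv t : 0 <= t -> lint (hat (v t)) by move=> t0; exact/lint2_lint/(lint2_v ms).
have lv' t : 0 <= t -> lint (hat (v' t)) by move=> t0; exact/lint2_lint/(lint2_v ms').
have lz1 : lint (hat z1) by case: hz => _ /lint2_hat/lint2_lint.
have z01 : 0 <= (0 : R) <= 1 by rewrite lexx ler01.
have ud t : 0 <= t ->
    uderiv (fun s x => sint (zd s) 0 x) t (fun x => sint (vd t) 0 x).
  move=> t0 e e0; have e2 : 0 < e / 2 by rewrite divr_gt0.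
  have [d1 d10 K1] := uderiv_crep ms' t0 e2; have [d2 d20 K2] := uderiv_crep ms t0 e2.
  exists (Num.min d1 d2); first by rewrite lt_min d10.
  move=> s s0; rewrite lt_min => /andP[sd1 sd2] x x01.
  have c1 r : 0 <= r -> lint (crep z r) by move=> r0; exact/continuous_lint/(continuous_crep ms).
  have c2 r : 0 <= r -> lint (crep z' r) by move=> r0; exact/continuous_lint/(continuous_crep ms').
  rewrite /zd /vd (sintB _ _ (c2 s s0) (c1 s s0)) (sintB _ _ (c2 t t0) (c1 t t0)).
  rewrite (sintB _ _ (lv' t t0) (lv t t0)).
  have alg (A1 A2 B1 B2 c C1 C2 : R) : A1 - A2 - (B1 - B2) - c * (C1 - C2) =
      (A1 - B1 - c * C1) - (A2 - B2 - c * C2) by ring.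
  rewrite alg; exact: (half_sub _ _ _ _ _ (K1 s s0 sd1 x x01) (K2 s s0 sd2 x x01) erefl).
have uniq t x : 0 <= t -> 0 <= x <= 1 -> zd t x = 0.
  apply: (@zero_data_unique _ a b a0 b0 zd vd) => //.
  - move=> {}t t0 {}x; apply: cvgB.
      exact: continuous_crep ms' _ t0 _.
    exact: continuous_crep ms _ t0 _.
  - move=> {}t t0 e e0; have e2 : 0 < e / 2 by rewrite divr_gt0.
    have [d1 d10 K1] := crep_unif ms' t0 e2; have [d2 d20 K2] := crep_unif ms t0 e2.
    exists (Num.min d1 d2); first by rewrite lt_min d10.
    move=> s s0; rewrite lt_min => /andP[sd1 sd2] {}x x01.
    have := K2 s s0 sd2 x x01; have := K1 s s0 sd1 x x01; rewrite /zd.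
    move: (crep z' s x) (crep z s x) (crep z' t x) (crep z t x) => A1 A2 B1 B2 k1 k2.
    rewrite -[e]mulr1; apply: (half_sub (A1 - B1) (A2 - B2)); rewrite ?mulr1//; ring.
  - by move=> {}x x01; rewrite /zd (crep0 ms)// (crep0 ms')// subrr.
  - move=> {}t t0 {}x x01.
    have E y : 0 <= y <= 1 -> sint (fun s => zd `|s| y) 0 t = crep_int z' t y - crep_int z t y.
      move=> y01; rewrite /zd sintB//.
        exact/continuous_lint/(continuous_crep_time ms').
      exact/continuous_lint/(continuous_crep_time ms).
    have cl c (h : R -> R) : lint h -> lint (fun y => c + sint h 0 y).
      move=> lh; apply: continuous_lint => y; apply: cvgD; first exact: cvg_cst.
      exact: continuous_sint.
    rewrite !E// (crep_wave ms' t0 x01) (crep_wave ms t0 x01) opprD addrACA; congr (_ + _).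
    apply: esym.
    apply: etrans (sintB _ _ (cl _ _ (lintB (lv' t t0) lz1)) (cl _ _ (lintB (lv t t0) lz1))).
    apply: eq_sint; first by case/andP: x01.
    have alg (I' I w' w y0 V' V Z : R) : a * (I' - I) + b * (w' - w) + (V' - V) =
        (a * I' + b * (w' - y0) + (V' - Z)) - (a * I + b * (w - y0) + (V - Z)) by ring.
    move=> y _; rewrite /vd /zd (sintB _ _ (lv' t t0) (lv t t0)).
    rewrite (sintB _ _ (lv' t t0) lz1) (sintB _ _ (lv t t0) lz1); exact: alg.
  - by move=> {}t t0; rewrite /zd (crep1 ms)// (crep1 ms')// subrr.
move=> t t0; split.
  move=> x x01; have /eqP := uniq t x t0 x01.
  by rewrite /zd subr_eq0 (crepE ms)// (crepE ms')// => /eqP.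
(* [sint (vd t) 0 x] is the time derivative of [sint (zd s) 0 x], which is now identically zero;
   vanishing for all [x], it forces [vd t] to vanish almost everywhere on ]0, 1[. *)
have V0 x : 0 <= x <= 1 -> sint (vd t) 0 x = 0.
  move=> x01; apply/eqP; rewrite -normr_le0; apply/ler_addgt0Pr => e e0; rewrite add0r.
  have [d d0 H] := ud t t0 e e0.
  have d20 : 0 < d / 2 by rewrite divr_gt0.
  have td : 0 <= t + d / 2 by rewrite addr_ge0// ltW.
  have dd : d / 2 < d by lra.
  have zs s : 0 <= s -> sint (zd s) 0 x = 0.
    move=> s0; rewrite (@eq_sint _ _ (cst 0)) ?sint_cst ?mul0r//; first by case/andP: x01.
    move=> y /andP[y0 yx]; rewrite uniq// y0 (le_trans yx)//; by case/andP: x01.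
  have := H (t + d / 2) td; rewrite addrAC subrr add0r (ger0_norm (ltW d20)).
  move=> /(_ dd x x01); rewrite !zs// subrr sub0r normrN normrM (ger0_norm (ltW d20)).
  by rewrite [leLHS]mulrC ler_pM2r.
apply: filterS (sint0_ae_eq0 (lvd t t0) V0) => x H x01.
have x01' : 0 < x < 1 by move: x01; rewrite /= in_itv.
by have /eqP := H x01; rewrite /vd !hatE// subr_eq0 => /eqP.
Qed.

End Uniqueness.

(** * Existence *)

Section Existence.
Context {R : realType}.
Local Notation hat f := (f \_ `]0, 1[).

Lemma hat_out (f : R -> R) x : (x <= 0) || (1 <= x) -> (hat f) x = 0.
Proof.
move=> x01; rewrite patchE ifF//; apply/negbTE; rewrite notin_setE/= in_itv/=.
by apply/negP; rewrite negb_and -!leNgt.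
Qed.

(** The last three conditions are, in terms of [u], z_x = [g] and z_t = [z1] at time 0, and the
    boundary condition at x = 0. *)
Lemma dalembert_generator (g z1 : R -> R) (a b : R) : 0 < a -> 0 < b ->
  L2 `]0, 1[ g -> L2 `]0, 1[ z1 -> exists u : R -> R,
  [/\ measurable_fun setT u, (sqn setT u < +oo)%E,
      forall x, 0 < x < 1 -> - u (1 - x) - u (x - 1) = g x,
      forall x, 0 < x < 1 -> u (1 - x) - u (x - 1) = z1 x &
      forall t, 0 <= t -> - u (t + 1) - u (t - 1) =
        a * dalembert u t 0 + b * (u (t + 1) - u (t - 1))].
Proof.
move=> a0 b0 /lint2_hat lg /lint2_hat lz1.
have b1 : 1 + b != 0 by rewrite gt_eqF// addr_gt0.
(* On ]0, 1[ only the arguments [1 - s] matter, on ]-1, 0[ only [s + 1]. *)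
pose u0 s := 2^-1 * (((hat z1) (1 - s) - (hat g) (1 - s)) - ((hat g) (s + 1) + (hat z1) (s + 1))).
have lu0 : lint2 u0.
  apply/lint2Z/lint2B.
    by apply: lint2B; exact: lint2_reflect.
  by apply: lint2D; exact: lint2_shift.
(* These are the coefficients of [W' + k * W = - m * u (t - 1)] and of the delay equation, both
   divided by [1 + b]; [w0] is the initial trace [W 0]. *)
pose k := a / (1 + b); pose m := 2 / (1 + b); pose w0 := sint u0 (- 1) 1.
have [u [lu ult uge]] := @delay_solution R ((b - 1) / (1 + b)) k m w0 u0 lu0.
pose W := delay_W k m w0 u.
have cW : continuous W by exact: continuous_delay_W.
have pW : primitive W (fun t => - ((2 * u (t - 1) + a * W t) / (1 + b))).
  have := @primitive_delay_W _ k m w0 u lu; congr primitive; apply/funext => t.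
  by rewrite -/W /k /m; field.
have W0 : W 0 = sint u (- 1) 1.
  rewrite /W /delay_W mulr0 expR0 mul1r sintaa mulr0 subr0.
  apply: eq_sint_oo; [exact: lint2_lint|exact: lint2_lint|lra|].
  by move=> x /andP[_ x1]; rewrite ult.
have uW t : 0 <= t -> (1 + b) * u (t + 1) = (b - 1) * u (t - 1) - a * W t.
  move=> t0; rewrite (uge (t + 1)); last by rewrite lerDr.
  rewrite addrK -/W (_ : t + 1 - 2 = t - 1); last by ring.
  by rewrite /k; field.
have u_lt s : s < - 1 -> u s = 0.
  move=> s1; rewrite ult; last by lra.
  have h1 : (1 - s <= 0) || (1 <= 1 - s) by apply/orP; right; lra.
  have h2 : (s + 1 <= 0) || (1 <= s + 1) by apply/orP; left; lra.
  by rewrite /u0 !hat_out//; ring.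
have jump := primitive_jump b0 lu pW W0 uW.
have fin := delay_finite_energy a0 b0 lu pW cW W0 uW u_lt.
have u01 x : 0 < x < 1 -> u (1 - x) = 2^-1 * (z1 x - g x) /\ u (x - 1) = 2^-1 * (- (g x + z1 x)).
  move=> /andP[x0 x1]; rewrite !ult; [|lra|lra].
  have e1 : 1 - (1 - x) = x by ring. have e2 : x - 1 + 1 = x by ring.
  have h1 : (1 - x + 1 <= 0) || (1 <= 1 - x + 1) by apply/orP; right; lra.
  have h2 : (1 - (x - 1) <= 0) || (1 <= 1 - (x - 1)) by apply/orP; right; lra.
  rewrite /u0 e1 e2 !(hat_out _ h1) !(hat_out _ h2) !hatE ?x0//.
  by split; ring.
exists u; split => //; first by case: lu.
- by move=> x /u01[-> ->]; field.
- by move=> x /u01[-> ->]; field.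
- move=> t t0.
  have -> : dalembert u t 0 = W t.
    rewrite jump// /dalembert subr0 add0r -(sint_chasles 0 (t - 1) (t + 1) (lint2_lint lu)); ring.
  have := uW t t0; lra.
Qed.

Lemma mild_solution_exists (a b : R) (z0 z1 : R -> R) : 0 < a -> 0 < b -> H0 z0 z1 ->
  exists z v : R -> R -> R, mild_solution a b z0 z1 z v /\
    exists q : R -> R, L2 `]0, +oo[ q /\ has_dx_trace z 1 q.
Proof.
move=> a0 b0 [[[g hg] z01] l1].
have [u [mu_ u_fin ug uz1 bc]] := dalembert_generator a0 b0 hg.1 l1.
have lu := sqn_lint2 mu_ u_fin.
have v0 x : 0 < x < 1 -> dalembert_t u 0 x = z1 x.
  by move=> x01; rewrite /dalembert_t add0r sub0r uz1.
have init x : 0 <= x <= 1 -> dalembert u 0 x = z0 x.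
  move=> /andP[x0 x1]; have [lg gE] := has_derivP hg.
  have := primitive_dalembert mu_ u_fin 0 x 1; rewrite dalembert1 sub0r => Ex.
  (* [z0] is recovered from its derivative and [z0 1 = 0], since [dalembert] also vanishes at x =
     1. *)
  have Sx : z0 x = - sint (hat g) x 1.
    rewrite (gE x) ?x0//; have := gE 1; rewrite z01 ler01 lexx => /(_ isT) E1.
    by rewrite -(sint_chasles 0 x 1 (lint2_lint lg)) in E1; lra.
  rewrite Sx -[LHS]opprK Ex; congr (- _); apply: eq_sint_oo => //.
  - exact/lint2_lint/lint2_dalembert_x.
  - exact: lint2_lint.
  - move=> y /andP[xy y1]; have y01 : 0 < y < 1 by rewrite y1 (le_lt_trans x0 xy).
    by rewrite hatE// /dalembert_x add0r sub0r ug.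
exists (dalembert u), (dalembert_t u); split; last first.
  exists (fun s => - 2 * u s); split; last exact: dx_trace_dalembert.
  apply: sqn_L2 => //.
    apply/(measurable_restrictT _ _).1 => //; apply: measurable_funTS.
    exact: measurable_funM.
  apply: (@le_lt_trans _ _ (sqn setT (fun s => - 2 * u s))).
    by apply: sub_sqn => //; exact: measurable_funM.
  rewrite (_ : sqn _ _ = 4%:E * sqn setT u)%E; last first.
    rewrite -ge0_integralZl_EFin//.
    - by apply: eq_integral => x _; rewrite -EFinM; congr EFin; ring.
    - by move=> x _; rewrite lee_fin sqr_ge0.
    - exact: measurable_sqr.
  by rewrite lte_mul_pinfty// ?lee_fin.
split.
- exact: continuous_dalembert.
- exact: time_deriv_dalembert.
- exact: init.
- by apply: aeW => x /=; rewrite in_itv/= => /v0.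
- move=> t t0; exists (dalembert_p u t); split.
  + exact: has_deriv_time_int_dalembert.
  + apply: has_deriv_eq (has_deriv_dalembert_p mu_ u_fin t) _.
    by move=> x x01; rewrite v0.
  + by rewrite -(init 0) ?lexx ?ler01//; exact: dalembert_wave.
Qed.

End Existence.

Unset Implicit Arguments.

Theorem lemma2p3 (R : realType) (c0 c1 : R)
    (hc0 : 0 < c0 < 1) (hc1 : 0 < c1)
    (z0 z1 : R -> R) (hz : H0 z0 z1) :
  exists z v : R -> R -> R,
    [/\ mild_solution (c1 / (1 - c0)) (c0 / (1 - c0)) z0 z1 z v,
        (forall z' v' : R -> R -> R,
           mild_solution (c1 / (1 - c0)) (c0 / (1 - c0)) z0 z1 z' v' ->
           forall t, 0 <= t ->
             (forall x, 0 <= x <= 1 -> z' t x = z t x) /\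
             ae_eq (@lebesgue_measure R) `]0, 1[%classic (v' t) (v t)) &
        exists q : R -> R, L2 `]0, +oo[ q /\ has_dx_trace z 1 q].
Proof.
have [c0_gt0 c0_lt1] := andP hc0.
have c0' : 0 < 1 - c0 by rewrite subr_gt0.
have a0 : 0 < c1 / (1 - c0) by rewrite divr_gt0.
have b0 : 0 < c0 / (1 - c0) by rewrite divr_gt0.
have [z [v [ms tr]]] := mild_solution_exists a0 b0 hz.
exists z, v; split => // z' v' ms'.
exact: mild_solution_unique a0 b0 hz ms ms'.
Qed.
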